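(* There is an algorithm that solves each instance $(G,k,\mathcal{S},\mathcal{U})$ of Set-Restricted Disjoint Connected Subgraphs, where $G$ is a connected well-partitioned chordal graph on $n$ vertices given along with a partition tree $\mathcal{T}$, in time $2^{\mathcal{O}(s\log s)}\cdot n$, where $s=\sum_{i=1}^{k}|S_i|$ for $\mathcal{S}=\{S_1,\dots,S_k\}$.
   Context: All graphs are finite, simple and undirected. A connected graph $G$ is a well-partitioned chordal graph if there exist a partition $\mathcal{P}$ of $V(G)$ and a tree $\mathcal{T}$ with vertex set $\mathcal{P}$ such that: (i) each part $X\in\mathcal{P}$ is a clique in $G$; (ii) for each edge $XY\in E(\mathcal{T})$ there are $X'\subseteq X$ and $Y'\subseteq Y$ such that the edges of $G$ between $X$ and $Y$ are exactly the pairs $xy$ with $x\in X'$, $y\in Y'$; (iii) for distinct $X,Y\in\mathcal{P}$ with $XY\notin E(\mathcal{T})$, there are no edges of $G$ between $X$ and $Y$. Such a $\mathcal{T}$ is a partition tree of $G$. Set-Restricted Disjoint Connected Subgraphs: the input is a graph $G$, a set $\mathcal{S}=\{S_1,\dots,S_k\}$ of pairwise disjoint vertex sets of $G$ (terminal sets), and a set $\mathcal{U}=\{U_1,\dots,U_k\}$ of $k$ vertex subsets of $G$ (domains). The question is whether $G$ contains $k$ pairwise vertex-disjoint connected subgraphs $F_1,\dots,F_k$ such that for each $i\in\{1,\dots,k\}$, $S_i\subseteq V(F_i)\subseteq U_i$.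
   Formalization: The input is read by random access and the given partition tree includes, for each vertex and bag, whether the vertex has a neighbour in that other bag (the sets X', Y'); for an empty terminal set S_i the subgraph F_i may be empty. Without these, time linear in n is impossible. *)

(* Defs.v *)
From HB Require Import structures.
From mathcomp Require Import all_boot.
Set Implicit Arguments.
Unset Strict Implicit.
Unset Printing Implicit Defensive.

(** * Graphs *)

Record sgraph (T : finType) := SGraph {
  adj :> rel T;
  adj_sym : symmetric adj;
  adj_irr : irreflexive adj }.

Definition connected_graph (T : finType) (G : sgraph T) : Prop :=
  0 < #|T| /\ forall x y : T, connect G x y.

Record subgraph (T : finType) (G : sgraph T) := Subgraph {
  sub_verts : {set T};
  sub_edge : rel T;
  sub_edge_sym : symmetric sub_edge;
  sub_edgeP : forall x y, sub_edge x y ->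
    [/\ x \in sub_verts, y \in sub_verts & G x y] }.

(* The null subgraph is allowed.  It can only be used for an index i whose
   terminal set is empty. *)
Definition connected_subgraph (T : finType) (G : sgraph T) (F : subgraph G) :=
  {in sub_verts F &, forall x y, connect (sub_edge F) x y}.

(** * Partition trees *)

(* In a symmetric irreflexive relation a repetition-free closed walk of length
   at most 2 is empty or goes back and forth along one edge; the graph-theoretic
   cycles are the longer ones. *)
Definition tree_on (V : finType) (P : {set V}) (E : rel V) : Prop :=
  [/\ symmetric E, irreflexive E, forall x y, E x y -> x \in P /\ y \in P,
      {in P &, forall x y, connect E x y}
    & forall c : seq V, ucycle E c -> size c <= 2].

Definition partition_tree (T : finType) (G : sgraph T)
    (P : {set {set T}}) (E : rel {set T}) : Prop :=
  [/\ partition P [set: T], tree_on P E,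
      forall X, X \in P -> {in X &, forall x y, x != y -> G x y},
      forall X Y, E X Y -> exists X' Y' : {set T},
        [/\ X' \subset X, Y' \subset Y
          & {in X & Y, forall x y, G x y = (x \in X') && (y \in Y')}]
    & {in P &, forall X Y, X != Y -> ~~ E X Y ->
        {in X & Y, forall x y, ~~ G x y}}].

(** * Set-Restricted Disjoint Connected Subgraphs *)

Definition srdcs (T : finType) (G : sgraph T) (k : nat)
    (S U : 'I_k -> {set T}) : Prop :=
  exists F : 'I_k -> subgraph G,
    [/\ forall i, connected_subgraph (F i),
        forall i j, i != j -> [disjoint sub_verts (F i) & sub_verts (F j)]
      & forall i, S i \subset sub_verts (F i) /\ sub_verts (F i) \subset U i].

(** * Word RAM, with structured control flow

    A machine has registers, a working memory, and read-only input arrays with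
    two indices.  All of them hold natural numbers below the bound [W]; an
    operation whose result is not below [W] blocks the machine.  Every node of
    an expression and every control step costs one time unit. *)

Inductive binop := Add | Sub | Mul | Div | Mod | Eq | Lt.

Definition binop_sem (o : binop) (x y : nat) : nat :=
  match o with
  | Add => x + y
  | Sub => x - y
  | Mul => x * y
  | Div => x %/ y
  | Mod => x %% y
  | Eq => x == y
  | Lt => x < y
  end.

Inductive expr :=
  | Num of nat
  | Reg of nat
  | Mem of expr
  | Inp of nat & expr & expr  (* array number, row, column *)
  | Bin of binop & expr & expr.

Inductive cmd :=
  | Skip
  | Assign of nat & expr        (* register := value *)
  | Store of expr & expr      (* memory[address] := value *)
  | Seq of cmd & cmd
  | If of expr & cmd & cmd
  | While of expr & cmd.

Record state := State { regs : nat -> nat; memory : nat -> nat }.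

Definition init_state : state := State (fun=> 0) (fun=> 0).

Definition update (f : nat -> nat) (a v : nat) : nat -> nat :=
  fun b => if b == a then v else f b.

Definition word (W v : nat) : option nat := if v < W then Some v else None.

Fixpoint eval (W : nat) (inp : nat -> nat -> nat -> nat) (s : state) (e : expr)
    : option nat :=
  match e with
  | Num m => word W m
  | Reg x => word W (regs s x)
  | Mem e1 => obind (fun a => word W (memory s a)) (eval W inp s e1)
  | Inp a e1 e2 =>
      obind (fun i => obind (fun j => word W (inp a i j)) (eval W inp s e2))
            (eval W inp s e1)
  | Bin o e1 e2 =>
      obind (fun x => obind (fun y => word W (binop_sem o x y))
                            (eval W inp s e2))
            (eval W inp s e1)
  end.

Fixpoint cost (e : expr) : nat :=
  match e with
  | Num _ | Reg _ => 1
  | Mem e1 => (cost e1).+1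
  | Inp _ e1 e2 | Bin _ e1 e2 => (cost e1 + cost e2).+1
  end.

(* [exec W inp c s t s']: from [s], the program [c] halts in [s'] after exactly
   [t] time units. *)
Inductive exec (W : nat) (inp : nat -> nat -> nat -> nat) :
    cmd -> state -> nat -> state -> Prop :=
  | exec_skip s : exec W inp Skip s 1 s
  | exec_set s x e v : eval W inp s e = Some v ->
      exec W inp (Assign x e) s (cost e).+1 (State (update (regs s) x v) (memory s))
  | exec_store s e1 e2 a v :
      eval W inp s e1 = Some a -> eval W inp s e2 = Some v ->
      exec W inp (Store e1 e2) s (cost e1 + cost e2).+1
        (State (regs s) (update (memory s) a v))
  | exec_seq s s1 s2 c1 c2 t1 t2 :
      exec W inp c1 s t1 s1 -> exec W inp c2 s1 t2 s2 ->
      exec W inp (Seq c1 c2) s (t1 + t2) s2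
  | exec_if s s1 e c1 c2 v t : eval W inp s e = Some v ->
      exec W inp (if v != 0 then c1 else c2) s t s1 ->
      exec W inp (If e c1 c2) s (cost e + t).+1 s1
  | exec_while_stop s e c : eval W inp s e = Some 0 ->
      exec W inp (While e c) s (cost e).+1 s
  | exec_while_loop s s1 s2 e c v t1 t2 :
      eval W inp s e = Some v -> v != 0 ->
      exec W inp c s t1 s1 -> exec W inp (While e c) s1 t2 s2 ->
      exec W inp (While e c) s (cost e + t1 + t2).+1 s2.

Lemma exec_det W inp c s t1 s1 t2 s2 :
  exec W inp c s t1 s1 -> exec W inp c s t2 s2 -> t1 = t2 /\ s1 = s2.
Proof.
move=> H; elim: H t2 s2 => {c s t1 s1}.
- by move=> s t2 s2 H; inversion H.
- move=> s x e v He t2 s2 H; inversion H as [|? ? ? v' He'| | | | |]; subst.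
  by move: He'; rewrite He => -[->].
- move=> s e1 e2 a v H1 H2 t2 s2 H.
  inversion H as [| |? ? ? a' v' H1' H2'| | | |]; subst.
  by move: H1' H2'; rewrite H1 H2 => -[->] [->].
- move=> s s1 s2 c1 c2 t1 t2 _ IH1 _ IH2 t' s' H.
  inversion H as [| | |? s1' ? ? ? t1' t2' E1 E2| | |]; subst.
  have [-> ?] := IH1 _ _ E1; subst.
  by have [-> ->] := IH2 _ _ E2.
- move=> s s1 e c1 c2 v t He _ IH t' s' H.
  inversion H as [| | | |? ? ? ? ? v' t2' He' E| |]; subst.
  move: He' E; rewrite He => -[<-] E.
  by have [-> ->] := IH _ _ E.
- move=> s e c He t' s' H.
  inversion H as [| | | | |? ? ? He'|? ? ? ? ? v' ? ? He' v'0]; subst => //.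
  by move: He' v'0; rewrite He => -[<-].
- move=> s s1 s2 e c v t1 t2 He v0 _ IH1 _ IH2 t' s' H.
  inversion H as [| | | | |? ? ? He'|? s1' ? ? ? v' ? ? He' _ E1 E2]; subst.
    by move: He' v0; rewrite He => -[->].
  have [-> ?] := IH1 _ _ E1; subst.
  by have [-> ->] := IH2 _ _ E2.
Qed.

(** * Presentation of an instance to the machine *)

Definition array1 (n : nat) (f : 'I_n -> nat) (i : nat) : nat :=
  oapp f 0 (insub i).

Definition array2 (m n : nat) (f : 'I_m -> 'I_n -> nat) (i j : nat) : nat :=
  array1 (fun x => array1 (f x) j) i.

(* [bags] numbers the nodes of the tree [E] on [P]; [par] is the parent function
   of the tree rooted at the node numbered [r], with [par r = r]. *)
Definition rooted_numbering (T : finType) (P : {set {set T}}) (E : rel {set T})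
    (t : nat) (bags : 'I_t -> {set T}) (r : 'I_t) (par : 'I_t -> 'I_t) : Prop :=
  [/\ injective bags, bags @: [set: 'I_t] = P, par r = r,
      forall X, fconnect par X r
    & forall X Y, E (bags X) (bags Y) =
        (X != Y) && ((par X == Y) || (par Y == X))].

(* Array 0: n, the number t of bags, k.
   Array 1: adjacency matrix of G.
   Array 2: number of the bag containing v.
   Array 3: number of the parent of a bag.
   Array 4: boundaries; entry (v, Y) tells whether v, lying in a bag X other
            than Y, belongs to the boundary of X towards Y.  The boundaries are
            part of a given partition tree: an algorithm that only has the
            other arrays may need quadratic time to find an edge of G
            between two adjacent bags.
   Array 5: i + 1 if v is in S_i, and 0 if v is not a terminal.
   Array 6: entry (i, v) tells whether v is in U_i. *)
Definition encode (n k t : nat) (G : sgraph 'I_n) (S U : 'I_k -> {set 'I_n})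
    (bags : 'I_t -> {set 'I_n}) (par : 'I_t -> 'I_t) (a i j : nat) : nat :=
  match a with
  | 0 => nth 0 [:: n; t; k] i
  | 1 => array2 (fun u v : 'I_n => nat_of_bool (G u v)) i j
  | 2 => array1 (fun v : 'I_n =>
           oapp (fun X : 'I_t => X : nat) 0 [pick X | v \in bags X]) i
  | 3 => array1 (fun X : 'I_t => par X : nat) i
  | 4 => array2 (fun (v : 'I_n) (Y : 'I_t) =>
           nat_of_bool ((v \notin bags Y) && [exists w in bags Y, G v w])) i j
  | 5 => array1 (fun v : 'I_n =>
           oapp (fun l : 'I_k => l.+1) 0 [pick l | v \in S l]) i
  | 6 => array2 (fun (l : 'I_k) (v : 'I_n) => nat_of_bool (v \in U l)) i j
  | _ => 0
  end.

(* The floor in [trunc_log 2 s] is harmless: for s >= 2 it is at least half of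
   log_2 s. *)
Definition O_slogs (h : nat -> nat) : Prop :=
  exists a s0, forall s, s0 <= s -> h s <= a * (s * trunc_log 2 s).

(* Main.v *)
From mathcomp Require Import all_boot zify.
Require Import Defs.
Set Implicit Arguments.
Unset Strict Implicit.
Unset Printing Implicit Defensive.

(** The bags decouple, and each bag is solved by dynamic programming over
    subsets.

    Let w be a terminal of S_l.  Every bag X that does not hold w has a next bag
    on the way to w, namely its parent when the tree is re-rooted at the bag of
    w ([toward]).  Say that S_l is separated at X in the direction of w when X
    does not hold w and some other terminal of S_l lies in another direction
    from X.  A connected F_l containing S_l must then cross the tree edge from X
    to the next bag, so it contains a vertex of X in the boundary of X towards
    that bag ([choice_of_subgraphs]).  Conversely, choose such vertices in every
    bag, each for one index l only, from U_l and outside the other terminal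
    sets, and let F_l consist of S_l and of the vertices chosen for l.  A tree
    edge of this kind is separated from both ends, its two boundaries are
    completely joined and the bags are cliques, so from every vertex of F_l one
    can walk inside F_l bag by bag to any terminal of S_l
    ([subgraphs_of_choice]).  Hence an instance is solvable exactly when the
    terminal sets lie in their domains and each bag, independently of the
    others, admits a choice that meets its requirements ([local_choice]); a bag
    has at most one requirement per terminal, so at most s of them.

    For each bag the algorithm keeps the table of the subsets of
    requirements that can be met with the vertices seen so far ([reach]).  A new
    vertex may join one set S_l, and it then meets all the requirements of S_l
    whose boundary contains it.  This takes time 2^s * O(s^2) per vertex.  The
    directions towards a terminal are found by climbing from its bag to the root
    of the given tree, which takes time O(n) per terminal ([climb],
    [direction_toward]).  The total is 2^O(s) * n, within the bound
    2^O(s log s) * n.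

    The program consists of nested counting loops.  [runs] is its Hoare logic
    with time bounds, [program_runs] shows that it computes [answer], and
    [answer_correct] that [answer] decides the problem. *)

(** * Subsets of an initial segment of the naturals, coded as numbers *)

Definition bit (R j : nat) : bool := odd (R %/ 2 ^ j).

Fixpoint mask (f : nat -> bool) (m : nat) : nat :=
  if m is m'.+1 then mask f m' + f m' * 2 ^ m' else 0.

Lemma mask_lt f m : mask f m < 2 ^ m.
Proof.
elim: m => //= m IH; rewrite expnS mul2n -addnn.
by case: (f m); rewrite ?mul1n ?mul0n; lia.
Qed.

Lemma eq_mask f g m : (forall j, j < m -> f j = g j) -> mask f m = mask g m.
Proof.
elim: m => //= m IH H; rewrite IH ?H // => j jm; apply: H; lia.
Qed.

Lemma leq_mask (f g : nat -> bool) m :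
  (forall j, j < m -> f j -> g j) -> mask f m <= mask g m.
Proof.
elim: m => //= m IH H; apply: leq_add.
  by apply: IH => j jm; apply: H; lia.
by have := H m (leqnn _); case: (f m) => // ->.
Qed.

Lemma bit_mask f m j : bit (mask f m) j = (j < m) && f j.
Proof.
elim: m => [|m IH] /=; first by rewrite /bit div0n.
have [ltjm|] := ltnP j m.
  rewrite (ltnW ltjm : j < m.+1) /= -[RHS]andTb -ltjm -IH /bit.
  have -> : f m * 2 ^ m = (f m * 2 ^ (m - j)) * 2 ^ j.
    by rewrite -mulnA -expnD subnK // ltnW.
  rewrite divnDMl ?expn_gt0 // oddD oddM oddX.
  have -> : (m - j == 0) = false by lia.
  by rewrite andbF addbF.
rewrite leq_eqVlt => /orP[/eqP<-|ltmj].
  rewrite ltnSn /= /bit divnDMl ?expn_gt0 //.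
  by rewrite divn_small ?mask_lt //= add0n oddb.
rewrite ltnS leqNgt ltmj /= /bit divn_small //.
apply: leq_trans (mask_lt f m.+1) _.
by rewrite leq_exp2l.
Qed.

Lemma mask_bit m R : R < 2 ^ m -> mask (bit R) m = R.
Proof.
elim: m R => [|m IH] R /=; first by rewrite expn0 ltnS leqn0 => /eqP.
rewrite expnS => ltR.
have dR := divn_eq R (2 ^ m).
have bR : bit R m * 2 ^ m = R %/ 2 ^ m * 2 ^ m.
  have : R %/ 2 ^ m < 2 by rewrite ltn_divLR ?expn_gt0.
  by rewrite /bit; case: (R %/ 2 ^ m) => [|[|]].
rewrite bR [RHS]dR addnC; congr (_ + _).
rewrite -[RHS](IH (R %% 2 ^ m)) ?ltn_pmod ?expn_gt0 //.
apply: eq_mask => j ltjm; rewrite /bit {1}dR.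
have -> : R %/ 2 ^ m * 2 ^ m = (R %/ 2 ^ m * 2 ^ (m - j)) * 2 ^ j.
  by rewrite -mulnA -expnD subnK // ltnW.
rewrite divnMDl ?expn_gt0 // oddD oddM oddX.
have -> : (m - j == 0) = false by lia.
by rewrite andbF.
Qed.

Lemma mask_full m : mask (fun=> true) m = 2 ^ m - 1.
Proof.
elim: m => //= m ->; rewrite mul1n expnS; have := expn_gt0 2 m; lia.
Qed.

(** * A program logic with time bounds for the word machine *)

Section Machine.

Variables (inp : nat -> nat -> nat -> nat) (B W : nat).

(** Evaluation on unbounded naturals: the machine agrees with it as long as no
    intermediate result leaves the word size, see [eval_value]. *)
Fixpoint value (s : state) (e : expr) : nat :=
  match e with
  | Num m => m
  | Reg x => regs s x
  | Mem e1 => memory s (value s e1)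
  | Inp a e1 e2 => inp a (value s e1) (value s e2)
  | Bin o e1 e2 => binop_sem o (value s e1) (value s e2)
  end.

Fixpoint nums_lt (b : nat) (e : expr) : bool :=
  match e with
  | Num m => m < b
  | Reg _ => true
  | Mem e1 => nums_lt b e1
  | Inp _ e1 e2 | Bin _ e1 e2 => nums_lt b e1 && nums_lt b e2
  end.

Definition bounded (s : state) : Prop :=
  (forall x, regs s x < B) /\ (forall a, memory s a < B).

(** Any bound on the sizes of the expressions of the program would do; it is
    also the exponent by which the word size exceeds the register contents. *)
Definition max_cost := 200.

Definition small (e : expr) : bool :=
  (cost e <= max_cost) && nums_lt 4 e.

(** Registers and memory cells are kept below [B]; addresses and other
    intermediate results may exceed [B], but an expression of size c on such
    data stays below [B ^ c], hence within the words. *)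
Definition wide : Prop :=
  [/\ 4 <= B, forall a i j, (inp a i j).+1 < B & B ^ max_cost <= W].

Hypothesis wd : wide.

Let B_ge4 : 4 <= B. Proof. by case: wd. Qed.
Let inpB a i j : (inp a i j).+1 < B. Proof. by case: wd. Qed.
Let BW : B ^ max_cost <= W. Proof. by case: wd. Qed.

Lemma binop_lt o x y a b : x < B ^ a -> y < B ^ b -> 0 < a -> 0 < b ->
  binop_sem o x y < B ^ (a + b).+1.
Proof.
move=> xa yb a0 b0.
have Ba : B <= B ^ a by rewrite -{1}[B]expn1 leq_pexp2l //; lia.
have Bb : B <= B ^ b by rewrite -{1}[B]expn1 leq_pexp2l //; lia.
rewrite expnS expnD.
have H1 : x * y < B ^ a * B ^ b by nia.
have H2 : B ^ a * B ^ b <= B * (B ^ a * B ^ b) by nia.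
apply: leq_trans H2.
case: o => /=; first by nia.
- by nia.
- by [].
- by have := leq_div x y; nia.
- by have := leq_mod x y; nia.
- by case: (x == y); nia.
- by case: (x < y); nia.
Qed.

Lemma value_lt s e : bounded s -> nums_lt 4 e -> value s e < B ^ cost e.
Proof.
move=> [rB mB].
have B1 c : B <= B ^ c.+1 by rewrite -{1}[B]expn1 leq_pexp2l //; lia.
have pc e' : 0 < cost e' by case: e'.
elim: e => [m|x|e1 IH1|a e1 IH1 e2 IH2|o e1 IH1 e2 IH2] /=.
- by rewrite expn1 => m4; lia.
- by rewrite expn1.
- by move=> _; apply: leq_trans (mB _) (B1 _).
- by move=> _; apply: leq_trans (B1 _); apply: ltnW.
- by move=> /andP[/IH1 h1 /IH2 h2]; apply: binop_lt.
Qed.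

Lemma eval_value s e : bounded s -> small e ->
  eval W inp s e = Some (value s e).
Proof.
move=> bs /andP[].
have W_ok e' : cost e' <= max_cost -> nums_lt 4 e' -> value s e' < W.
  move=> ce ne; apply: leq_trans (value_lt bs ne) _; apply: leq_trans BW.
  by rewrite leq_pexp2l //; lia.
elim: e => [m|x|e1 IH1|a e1 IH1 e2 IH2|o e1 IH1 e2 IH2] ce ne /=.
- by have := W_ok _ ce ne; rewrite /= /word => ->.
- by have := W_ok _ ce ne; rewrite /= /word => ->.
- rewrite IH1 //=; last by move: ce => /=; lia.
  by have := W_ok _ ce ne; rewrite /= /word => ->.
- have /= /andP[n1 n2] := ne.
  rewrite IH1 ?IH2 //=; try by move: ce => /=; lia.
  by have := W_ok _ ce ne; rewrite /= /word => ->.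
- have /= /andP[n1 n2] := ne.
  rewrite IH1 ?IH2 //=; try by move: ce => /=; lia.
  by have := W_ok _ ce ne; rewrite /= /word => ->.
Qed.

Definition set_reg (s : state) (x v : nat) : state :=
  State (update (regs s) x v) (memory s).
Definition set_mem (s : state) (a v : nat) : state :=
  State (regs s) (update (memory s) a v).

Definition runs (c : cmd) (s : state) (T : nat) (Q : state -> Prop) : Prop :=
  exists t s', [/\ exec W inp c s t s', t <= T, bounded s' & Q s'].

Lemma runs_weaken c s T T' (Q Q' : state -> Prop) :
  runs c s T Q -> T <= T' -> (forall s', bounded s' -> Q s' -> Q' s') ->
  runs c s T' Q'.
Proof.
move=> [t [s' [ex tT bs' Qs']]] TT QQ; exists t, s'; split => //.
  exact: leq_trans tT TT.
exact: QQ.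
Qed.

Lemma bounded_set_reg s x v : bounded s -> v < B -> bounded (set_reg s x v).
Proof.
move=> [rB mB] vB; split=> //= y; rewrite /update; case: ifP => // _; exact: rB.
Qed.

Lemma bounded_set_mem s a v : bounded s -> v < B -> bounded (set_mem s a v).
Proof.
move=> [rB mB] vB; split=> //= y; rewrite /update; case: ifP => // _; exact: mB.
Qed.

Lemma runs_skip s T (Q : state -> Prop) : bounded s -> 0 < T -> Q s ->
  runs Skip s T Q.
Proof. by move=> bs T0 Qs; exists 1, s; split=> //; constructor. Qed.

Lemma runs_assign s x e v T (Q : state -> Prop) :
  bounded s -> small e -> value s e = v -> v < B -> cost e < T ->
  Q (set_reg s x v) -> runs (Assign x e) s T Q.
Proof.
move=> bs se ev vB cT Qs; exists (cost e).+1, (set_reg s x v); split=> //.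
  by apply: exec_set; rewrite eval_value // ev.
exact: bounded_set_reg.
Qed.

Lemma runs_store s e1 e2 a v T (Q : state -> Prop) :
  bounded s -> small e1 -> small e2 -> value s e1 = a -> value s e2 = v ->
  v < B -> cost e1 + cost e2 < T ->
  Q (set_mem s a v) -> runs (Store e1 e2) s T Q.
Proof.
move=> bs s1 s2 ea ev vB cT Qs.
exists (cost e1 + cost e2).+1, (set_mem s a v); split=> //.
  by apply: exec_store; rewrite eval_value // ?ea ?ev.
exact: bounded_set_mem.
Qed.

Lemma runs_seq c1 c2 s T1 T2 T (Q1 Q : state -> Prop) :
  runs c1 s T1 Q1 ->
  (forall s1, bounded s1 -> Q1 s1 -> runs c2 s1 T2 Q) ->
  T1 + T2 <= T -> runs (Seq c1 c2) s T Q.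
Proof.
move=> [t1 [s1 [ex1 tT1 bs1 Q1s]]] H TT.
have [t2 [s2 [ex2 tT2 bs2 Q2s]]] := H _ bs1 Q1s.
exists (t1 + t2), s2; split=> //; first by apply: exec_seq ex1 ex2.
by apply: leq_trans TT; apply: leq_add.
Qed.

Lemma runs_if e b c1 c2 s T T' (Q : state -> Prop) :
  bounded s -> small e -> (value s e != 0) = b ->
  (b -> runs c1 s T Q) -> (~~ b -> runs c2 s T Q) ->
  cost e + T < T' -> runs (If e c1 c2) s T' Q.
Proof.
move=> bs se eb H1 H2 TT.
have : runs (if value s e != 0 then c1 else c2) s T Q.
  by rewrite eb; case: ifPn.
move=> [t [s' [ex tT bs' Qs]]]; exists (cost e + t).+1, s'; split=> //.
  by apply: exec_if ex; rewrite eval_value.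
lia.
Qed.

Fixpoint writes (c : cmd) : seq nat :=
  match c with
  | Skip | Store _ _ => [::]
  | Assign x _ => [:: x]
  | Seq c1 c2 | If _ c1 c2 => writes c1 ++ writes c2
  | While _ c1 => writes c1
  end.

(** The frame rule of registers: a loop invariant only has to speak of what the
    loop changes. *)
Lemma exec_regs c s t s' : exec W inp c s t s' ->
  forall x, x \notin writes c -> regs s' x = regs s x.
Proof.
elim=> {c s t s'} //=.
- by move=> s x e v _ y; rewrite inE /update => /negbTE->.
- move=> s s1 s2 c1 c2 t1 t2 _ IH1 _ IH2 x.
  by rewrite mem_cat negb_or => /andP[x1 x2]; rewrite IH2 ?IH1.
- move=> s s1 e c1 c2 v t _ _ IH x.
  by rewrite mem_cat negb_or => /andP[x1 x2]; apply: IH; case: ifP.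
- by move=> s s1 s2 e c v t1 t2 _ _ _ IH1 _ IH2 x xc; rewrite IH2 ?IH1.
Qed.

Definition For (x y : nat) (c : cmd) : cmd :=
  Seq (Assign x (Num 0))
      (While (Bin Lt (Reg x) (Reg y))
             (Seq c (Assign x (Bin Add (Reg x) (Num 1))))).

(** The invariant [I i] is asserted with the counter already advanced to [i], so
    that consecutive iterations match without an extra step.  The bound is read
    from register [y] at each test, so the body must not write it. *)
Lemma runs_for (I : nat -> state -> Prop) x y c s m T T'
    (Q : state -> Prop) :
  bounded s -> regs s y = m ->
  [&& y != x, y \notin writes c & x \notin writes c] ->
  I 0 (set_reg s x 0) ->
  (forall i si, i < m -> bounded si -> regs si x = i ->
     (forall z, z \notin x :: writes c -> regs si z = regs s z) ->
     I i si -> runs c si T (fun s' => I i.+1 (set_reg s' x i.+1))) ->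
  (forall s', bounded s' -> I m s' ->
     (forall z, z \notin x :: writes c -> regs s' z = regs s z) -> Q s') ->
  m * (T + 8) + 6 <= T' ->
  runs (For x y c) s T' Q.
Proof.
move=> bs ym /and3P[yx yc xc] I0 step QI TT.
have mB : m < B by rewrite -ym; case: bs.
suff loop d i si : i + d = m -> bounded si -> regs si x = i ->
    (forall z, z \notin x :: writes c -> regs si z = regs s z) -> I i si ->
    runs (While (Bin Lt (Reg x) (Reg y))
             (Seq c (Assign x (Bin Add (Reg x) (Num 1))))) si
      (d * (T + 8) + 4) Q.
  apply: (@runs_seq _ _ _ 2 (m * (T + 8) + 4) _
           (fun s1 => s1 = set_reg s x 0)) => //.
  - by apply: (runs_assign (v := 0)) => //; lia.
  - move=> s1 _ ->; apply: (loop m 0) => //.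
    + apply: bounded_set_reg => //; lia.
    + by rewrite /= /update eqxx.
    + by move=> z; rewrite inE negb_or /= /update => /andP[/negbTE->].
  - lia.
elim: d i si => [|d IH] i si im bi xi fr Ii.
  have ei : i = m by lia.
  exists 4, si; split => //; last by apply: QI => //; rewrite -ei.
  apply: exec_while_stop; rewrite eval_value //= xi fr ?ym ?inE ?negb_or ?yx //.
  by rewrite ei ltnn.
have lim : i < m by lia.
have [t1 [s1 [ex1 t1T b1 I1]]] := step i si lim bi xi fr Ii.
have xs1 : regs s1 x = i by rewrite (exec_regs ex1).
have [||||t2 [s2 [ex2 t2T b2 I2]]] := IH i.+1 (set_reg s1 x i.+1) _ _ _ _ I1.
- lia.
- apply: bounded_set_reg => //; lia.
- by rewrite /= /update eqxx.
- move=> z zc; have := zc; rewrite inE negb_or /= /update => /andP[/negbTE-> zc'].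
  by rewrite (exec_regs ex1 zc') fr.
exists (3 + (t1 + 4) + t2).+1, s2; split=> //; last by lia.
apply: (@exec_while_loop _ _ _ (set_reg s1 x i.+1) _ _ _ 1) => //.
  rewrite eval_value //= xi fr ?ym ?inE ?negb_or ?yx //.
  by rewrite lim.
apply: exec_seq ex1 _; apply: (@exec_set _ _ _ _ _ i.+1).
by rewrite eval_value //= xs1 addn1.
Qed.

End Machine.

Section StraightLine.

Variables (inp : nat -> nat -> nat -> nat) (B W : nat).
Hypothesis wd : wide inp B W.

Lemma runs_assign_seq s x e v c T T' (Q : state -> Prop) :
  bounded B s -> small e -> value inp s e = v -> v < B ->
  (bounded B (set_reg s x v) -> runs inp B W c (set_reg s x v) T Q) ->
  (cost e).+1 + T <= T' -> runs inp B W (Seq (Assign x e) c) s T' Q.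
Proof.
move=> bs se ev vB H TT.
apply: (runs_seq (Q1 := fun s1 => s1 = set_reg s x v) _ _ TT).
  exact: (runs_assign wd (v := v)).
by move=> s1 b1 e1; move: b1; rewrite e1 => /H.
Qed.

Lemma runs_store_seq s e1 e2 a v c T T' (Q : state -> Prop) :
  bounded B s -> small e1 -> small e2 -> value inp s e1 = a ->
  value inp s e2 = v -> v < B ->
  (bounded B (set_mem s a v) -> runs inp B W c (set_mem s a v) T Q) ->
  (cost e1 + cost e2).+1 + T <= T' -> runs inp B W (Seq (Store e1 e2) c) s T' Q.
Proof.
move=> bs s1 s2 ea ev vB H TT.
apply: (runs_seq (Q1 := fun s1 => s1 = set_mem s a v) _ _ TT).
  exact: (runs_store wd (a := a) (v := v)).
by move=> s3 b1 e3; move: b1; rewrite e3 => /H.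
Qed.

End StraightLine.

(** * Three infinite arrays in one memory *)

(** Since a <= a + b, the number (a + b)^2 + a determines a + b, and then a.
    Unlike a row-major layout this needs no bound on the indices. *)
Definition addr (r a b : nat) : nat := 3 * ((a + b) * (a + b) + a) + r.

Lemma addr_inj r a b r' a' b' : r < 3 -> r' < 3 ->
  (addr r a b == addr r' a' b') = [&& r == r', a == a' & b == b'].
Proof.
move=> r3 r3'; apply/eqP/and3P; last by case=> /eqP-> /eqP-> /eqP->.
rewrite /addr => e.
have er : r = r' by lia.
have e2 : (a + b) * (a + b) + a = (a' + b') * (a' + b') + a' by lia.
have es : a + b = a' + b' by nia.
have ea : a = a' by rewrite es in e2; lia.
split; apply/eqP; lia.
Qed.

Definition cell (s : state) (r a b : nat) : nat := memory s (addr r a b).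

Lemma cell_set_mem s r a b v r' a' b' : r < 3 -> r' < 3 ->
  cell (set_mem s (addr r a b) v) r' a' b' =
  if [&& r' == r, a' == a & b' == b] then v else cell s r' a' b'.
Proof. by move=> r3 r3'; rewrite /cell /= /update addr_inj. Qed.

(** The three arrays of the program: the list of terminals, the directions found
    by climbing, and the table of the dynamic program. *)
Definition holds (s : state) (T : nat -> nat) (D G : nat -> nat -> nat)
    : Prop :=
  [/\ forall j, cell s 0 j 0 = T j,
      forall j X, cell s 1 j X = D j X
    & forall X R, cell s 2 X R = G X R].

Lemma holds_set0 s T D G a v T' : holds s T D G ->
  (forall j, T' j = if j == a then v else T j) ->
  holds (set_mem s (addr 0 a 0) v) T' D G.
Proof.
move=> [hT hD hG] e; split=> [j|j X|X R]; rewrite cell_set_mem //=.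
by rewrite e hT andbT.
Qed.

Lemma holds_set1 s T D G a b v D' : holds s T D G ->
  (forall j X, D' j X = if (j == a) && (X == b) then v else D j X) ->
  holds (set_mem s (addr 1 a b) v) T D' G.
Proof.
move=> [hT hD hG] e; split=> [j|j X|X R]; rewrite cell_set_mem //=.
by rewrite e hD.
Qed.

Lemma holds_set2 s T D G a b v G' : holds s T D G ->
  (forall X R, G' X R = if (X == a) && (R == b) then v else G X R) ->
  holds (set_mem s (addr 2 a b) v) T D G'.
Proof.
move=> [hT hD hG] e; split=> [j|j X|X R]; rewrite cell_set_mem //=.
by rewrite e hG.
Qed.

Lemma eq_holds s T D G T' D' G' : holds s T D G ->
  (forall j, T j = T' j) -> (forall j X, D j X = D' j X) ->
  (forall X R, G X R = G' X R) -> holds s T' D' G'.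
Proof.
by move=> [hT hD hG] eT eD eG; split=> *; rewrite ?hT ?hD ?hG ?eT ?eD ?eG.
Qed.

(** * The algorithm as a function on numbers *)

(** [every] and [some] unfold one index at a time, as the counting loops do. *)
Fixpoint every (p : nat -> bool) (m : nat) : bool :=
  if m is m'.+1 then every p m' && p m' else true.

Fixpoint some (p : nat -> bool) (m : nat) : bool :=
  if m is m'.+1 then some p m' || p m' else false.

Lemma everyP (p : nat -> bool) m : reflect (forall j, j < m -> p j) (every p m).
Proof.
elim: m => [|m IH] /=; first by constructor.
apply: (iffP andP) => [[/IH H pm] j|H].
  by rewrite ltnS leq_eqVlt => /predU1P[->|/H].
by split; [apply/IH => j jm|]; apply: H => //; lia.
Qed.

Lemma someP (p : nat -> bool) m : reflect (exists2 j, j < m & p j) (some p m).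
Proof.
elim: m => [|m IH] /=; first by constructor; case.
apply: (iffP orP) => [[/IH[j jm pj]|pm]|[j]].
- by exists j => //; lia.
- by exists m.
- by rewrite ltnS leq_eqVlt => /predU1P[->|jm pj]; [right|left; apply/IH; exists j].
Qed.

Section Algorithm.

Variable inp : nat -> nat -> nat -> nat.

Let n := inp 0 0 0.
Let t := inp 0 1 0.
Let bag v := inp 2 v 0.
Let up X := inp 3 X 0.
Let bd v Y := inp 4 v Y.
Let lab v := inp 5 v 0.
Let dom l v := inp 6 l v.

Definition terminals_upto (i : nat) : seq nat :=
  [seq v <- iota 0 i | lab v != 0].
Definition terminals : seq nat := terminals_upto n.
Let s := size terminals.
Definition terminal (j : nat) : nat := nth 0 terminals j.

(** One more than the next bag from [X] towards [b], if [X] is met within [m]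
    steps from [b] to the root, and 0 otherwise; for [X = b] it is [b.+1].  The shift by one lets the
    initial contents 0 of the memory stand for the absence of an entry, and
    the next bag from [X] is then its parent. *)
Fixpoint climb (m b X : nat) : nat :=
  if X == b then b.+1 else
  if m is m'.+1 then (if X == up b then b.+1 else climb m' (up b) X) else 0.

Definition direction (j X : nat) : nat :=
  let c := climb t (bag (terminal j)) X in (c == 0) * up X + (c - 1).

(** The requirements of a bag [X] are numbered by the terminals: requirement [j]
    asks for a vertex of the set of terminal [j] in the boundary of [X] towards
    that terminal.  It is [idle] when there is nothing to ask. *)
Definition separated (j X j' : nat) : bool :=
  (lab (terminal j) == lab (terminal j')) && (direction j X != direction j' X).

Definition idle (X j : nat) : bool :=
  (direction j X == X) || ~~ some (separated j X) s.

(** Whether vertex [v] may be used for the terminal set that contains terminal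
    [j]; a terminal can only be used for its own set, to which it belongs
    anyhow. *)
Definition joinable (v j : nat) : bool :=
  (dom (lab (terminal j)).-1 v != 0) &&
  ((lab v == 0) || (lab v == lab (terminal j))).

Definition serves (v j j' : nat) : bool :=
  (lab (terminal j') == lab (terminal j)) && (bd v (direction j' (bag v)) != 0).

(** The requirements met once [v] joins the set of terminal [j]. *)
Definition served (v j R : nat) : nat :=
  mask (fun j' => serves v j j' || bit R j') s.

(** The table of bag [X] after the vertices below [i]: the subset [R] is marked
    when some of these vertices of [X] can join terminal sets so that, with the
    idle requirements counted as met, exactly those in [R] are met. *)
Fixpoint reach (i : nat) (X R : nat) : bool :=
  if i is v.+1 then
    reach v X R || (X == bag v) &&
      some (fun R0 => reach v X R0 &&
              some (fun j => joinable v j && (R == served v j R0)) s) (2 ^ s)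
  else (X < t) && (R == mask (idle X) s).

Definition in_domain (v : nat) : bool :=
  (lab v != 0) ==> (dom (lab v).-1 v != 0).

Definition answer : bool :=
  every in_domain n && every (fun X => reach n X (2 ^ s - 1)) t.

Lemma terminals_uptoS i :
  terminals_upto i.+1 =
  if lab i != 0 then rcons (terminals_upto i) i else terminals_upto i.
Proof.
rewrite /terminals_upto -addn1 iotaD filter_cat /= add0n.
by case: ifP; rewrite ?cats1 ?cats0.
Qed.

Lemma size_terminals_upto i : i <= n -> size (terminals_upto i) <= s.
Proof.
move=> le_in; rewrite /s /terminals /terminals_upto -(subnKC le_in) iotaD.
by rewrite filter_cat size_cat leq_addr.
Qed.

Lemma climbS m b X :
  climb m.+1 b X = if climb m b X != 0 then climb m b X else
                   if X == up (iter m up b) then (iter m up b).+1 else 0.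
Proof.
elim: m b => [|m IH] b.
  by rewrite /=; case: (X == b) => //; case: (X == up b).
rewrite -[climb m.+2 b X]/(if X == b then b.+1 else
  if X == up b then b.+1 else climb m.+1 (up b) X) IH.
rewrite -[climb m.+1 b X]/(if X == b then b.+1 else
  if X == up b then b.+1 else climb m (up b) X).
by rewrite -iterSr; case: (X == b) => //; case: (X == up b).
Qed.

(** This makes it possible to update the table of a bag in place, by scanning
    the subsets downwards: a vertex never acts on an entry that it has
    itself created. *)
Lemma served_ge v j R : R < 2 ^ s -> R <= served v j R.
Proof.
move=> ltR; rewrite -{1}(mask_bit ltR).
by apply: leq_mask => j' _ ->; rewrite orbT.
Qed.

End Algorithm.

(** * The program *)

(** [rN], [rT] and [rS] hold the numbers of vertices, bags and terminals, and [rP]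
    holds 2^s.  [rX] holds a bag, [rR] a subset and [rW] the weight of a bit.
    [rI], [rJ] and [rK] are counters; [rC] and [rQ] have several uses. *)
Local Notation rOut := 0.
Local Notation rN := 1.
Local Notation rT := 2.
Local Notation rS := 3.
Local Notation rP := 4.
Local Notation rI := 5.
Local Notation rX := 6.
Local Notation rJ := 7.
Local Notation rK := 8.
Local Notation rR := 9.
Local Notation rC := 10.
Local Notation rW := 11.
Local Notation rQ := 12.

Local Notation "x |+| y" := (Bin Add x y) (at level 50, left associativity).
Local Notation "x |-| y" := (Bin Sub x y) (at level 50, left associativity).
Local Notation "x |*| y" := (Bin Mul x y) (at level 40, left associativity).
Local Notation "x |=| y" := (Bin Eq x y) (at level 60, no associativity).
Local Notation "x <- e" := (Assign x e) (at level 70, no associativity).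
Local Notation "c1 ;; c2" := (Seq c1 c2) (at level 80, right associativity).

Definition Addr (r : nat) (a b : expr) : expr :=
  Num 3 |*| ((a |+| b) |*| (a |+| b) |+| a) |+| Num r.
Definition Bag v := Inp 2 v (Num 0).
Definition Up X := Inp 3 X (Num 0).
Definition Lab v := Inp 5 v (Num 0).
Definition Dom l v := Inp 6 l v.
Definition Terminal j := Mem (Addr 0 j (Num 0)).
Definition Climb j X := Mem (Addr 1 j X).
Definition Table X R := Mem (Addr 2 X R).
Definition Direction j X :=
  (Climb j X |=| Num 0) |*| Up X |+| (Climb j X |-| Num 1).

(** Lists the terminals, doubles [rP] up to 2^s and tests that terminals lie in
    their domains. *)
Definition collect : cmd :=
  For rI rN
    (If (Lab (Reg rI))
       (If (Dom (Lab (Reg rI) |-| Num 1) (Reg rI)) Skip (rOut <- Num 0) ;;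
        Store (Addr 0 (Reg rS) (Num 0)) (Reg rI) ;;
        rS <- Reg rS |+| Num 1 ;;
        rP <- Reg rP |+| Reg rP)
       Skip).

(** An entry is written only if it is still 0.  The climb therefore needs no
    test for the root, and its length can be any number that suffices for every
    bag. *)
Definition climb_all : cmd :=
  For rI rS
    (rX <- Bag (Terminal (Reg rI)) ;;
     Store (Addr 1 (Reg rI) (Reg rX)) (Reg rX |+| Num 1) ;;
     For rJ rT
       (rQ <- Up (Reg rX) ;;
        If (Climb (Reg rI) (Reg rQ)) Skip
           (Store (Addr 1 (Reg rI) (Reg rQ)) (Reg rX |+| Num 1)) ;;
        rX <- Reg rQ)).

Definition initialise : cmd :=
  For rX rT
    (rR <- Num 0 ;;
     rW <- Num 1 ;;
     For rJ rS
       (rC <- Direction (Reg rJ) (Reg rX) |=| Reg rX ;;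
        rQ <- Num 1 ;;
        For rK rS
          (If ((Lab (Terminal (Reg rJ)) |=| Lab (Terminal (Reg rK))) |*|
               (Num 1 |-| (Direction (Reg rJ) (Reg rX) |=|
                           Direction (Reg rK) (Reg rX))))
             (rQ <- Num 0) Skip) ;;
        If (Reg rC |+| Reg rQ) (rR <- Reg rR |+| Reg rW) Skip ;;
        rW <- Reg rW |+| Reg rW) ;;
     Store (Addr 2 (Reg rX) (Reg rR)) (Num 1)).

(** Marks the subset [served] from the subset [rR] when vertex [rI] joins the set
    of terminal [rK]. *)
Definition serve : cmd :=
  rC <- Num 0 ;;
  rW <- Num 1 ;;
  For rQ rS
    (If ((Lab (Terminal (Reg rQ)) |=| Lab (Terminal (Reg rK))) |*|
         Inp 4 (Reg rI) (Direction (Reg rQ) (Reg rX)) |+|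
         Bin Mod (Bin Div (Reg rR) (Reg rW)) (Num 2))
       (rC <- Reg rC |+| Reg rW) Skip ;;
     rW <- Reg rW |+| Reg rW) ;;
  Store (Addr 2 (Reg rX) (Reg rC)) (Num 1).

Definition sweep : cmd :=
  For rI rN
    (rX <- Bag (Reg rI) ;;
     For rJ rP
       (rR <- Reg rP |-| (Reg rJ |+| Num 1) ;;
        If (Table (Reg rX) (Reg rR))
          (For rK rS
             (If (Dom (Lab (Terminal (Reg rK)) |-| Num 1) (Reg rI) |*|
                  ((Lab (Reg rI) |=| Num 0) |+|
                   (Lab (Reg rI) |=| Lab (Terminal (Reg rK)))))
                serve Skip))
          Skip)).

Definition verdict : cmd :=
  For rX rT
    (If (Table (Reg rX) (Reg rP |-| Num 1)) Skip (rOut <- Num 0)).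

Definition program : cmd :=
  rN <- Inp 0 (Num 0) (Num 0) ;;
  rT <- Inp 0 (Num 1) (Num 0) ;;
  rP <- Num 1 ;;
  rOut <- Num 1 ;;
  collect ;; climb_all ;; initialise ;; sweep ;; verdict.

(** * The program computes the function *)

Section Verification.
Variables (inp : nat -> nat -> nat -> nat) (B W : nat).
Hypothesis wd : wide inp B W.

Let n := inp 0 0 0.
Let t := inp 0 1 0.
Let s := size (terminals inp).
Hypotheses (PB : 2 ^ s < B).

Let zero2 : nat -> nat -> nat := fun _ _ => 0.

Let B_ge4 : 4 <= B. Proof. by case: wd. Qed.
Let B_gt0 : 0 < B. Proof. exact: leq_trans B_ge4. Qed.
Let B_gt1 : 1 < B. Proof. exact: leq_trans B_ge4. Qed.
Let inpB a i j : (inp a i j).+1 < B. Proof. by case: wd. Qed.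
Let nB : n < B. Proof. by apply: ltnW; apply: inpB. Qed.
Let tB : t < B. Proof. by apply: ltnW; apply: inpB. Qed.
Let sn : s <= n.
Proof. by rewrite /s size_filter (leq_trans (count_size _ _)) ?size_iota. Qed.

(** The numerical constants in this and the following time bounds are generous
    counts of the nodes of the expressions in a loop body. *)
Lemma collect_runs st : bounded B st -> regs st rN = n ->
  regs st rS = 0 -> regs st rP = 1 -> regs st rOut = 1 ->
  holds st (fun=> 0) zero2 zero2 ->
  runs inp B W collect st (n * 200 + 6) (fun st' =>
    [/\ regs st' rS = s, regs st' rP = 2 ^ s, regs st' rN = n,
        regs st' rT = regs st rT
      & regs st' rOut = every (in_domain inp) n /\
        holds st' (terminal inp) zero2 zero2]).
Proof.
move=> bs eN eS eP eO hm.
pose I i st' := [/\ regs st' rS = size (terminals_upto inp i),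
  regs st' rP = 2 ^ size (terminals_upto inp i),
  regs st' rOut = every (in_domain inp) i
  & holds st' (nth 0 (terminals_upto inp i)) zero2 zero2].
apply: (runs_for wd (I := I) (m := n) (T := 190)) => //.
- split=> //=; apply: eq_holds hm _ _ _ => // j; by rewrite nth_nil.
- move=> i si lt_in bi xi fr [iS iP iO ih].
  have lts : size (terminals_upto inp i) <= s.
    by apply: size_terminals_upto; apply: ltnW.
  apply: (runs_if wd (b := inp 5 i 0 != 0) (T := 170)) => //.
    by rewrite /= xi.
    move=> labi.
  have lts1 : size (terminals_upto inp i.+1) <= s by apply: size_terminals_upto.
  rewrite terminals_uptoS labi size_rcons in lts1.
  apply: (runs_seq (T1 := 30) (T2 := 140)
    (Q1 := fun s1 => regs s1 rOut = every (in_domain inp) i.+1 /\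
      forall x, x != rOut -> regs s1 x = regs si x /\ memory s1 = memory si)) => //.
    apply: (runs_if wd (b := inp 6 (inp 5 i 0).-1 i != 0) (T := 5)) => //.
    - by rewrite /= xi subn1.
    - move=> di; apply: runs_skip => //; split=> //.
      by rewrite /= iO /in_domain labi di andbT.
    move=> di.
    apply: (runs_assign wd (v := 0)) => //.
    split; first by rewrite /= /in_domain labi (negbTE di) andbF.
    by move=> x; rewrite /= /update => /negbTE->.
  move=> s1 b1 [o1 fr1].
  have mem1 : memory s1 = memory si by case: (fr1 1 isT).
  apply: (runs_store_seq wd (a := addr 0 (size (terminals_upto inp i)) 0) (v := i)
            (T := 40)) => //=.
  - by rewrite (fr1 _ _).1 // iS.
  - by rewrite (fr1 _ _).1 // xi.
  - lia.
  move=> b2.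
  apply: (runs_assign_seq wd (v := (size (terminals_upto inp i)).+1) (T := 30)) => //=.
  - by rewrite (fr1 _ _).1 // iS addn1.
  - have := ltn_expl s (ltnSn 1); lia.
  move=> b3.
  apply: (runs_assign wd (v := 2 ^ (size (terminals_upto inp i)).+1)) => //=.
  - by rewrite /update /= (fr1 _ _).1 // iP expnS mul2n addnn.
  - apply: leq_ltn_trans PB; by rewrite leq_exp2l.
  rewrite /I terminals_uptoS labi size_rcons; split=> //=.
  apply: (@holds_set0 s1 (nth 0 (terminals_upto inp i))).
    by case: ih => *; split; rewrite /cell mem1.
  move=> j; rewrite nth_rcons; do 2!case: ltngtP => //; move=> *.
  by rewrite nth_default //; lia.
  move=> labi; apply: runs_skip => //; rewrite /I terminals_uptoS /= /in_domain.
  by rewrite (negbTE labi) andbT.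
- move=> s' b' [h1 h2 h3 h4] h5.
  by split=> //; rewrite h5.
- lia.
Qed.

Lemma value_Bin st o a b :
  value inp st (Bin o a b) = binop_sem o (value inp st a) (value inp st b).
Proof. by []. Qed.

Lemma value_Inp st a e f :
  value inp st (Inp a e f) = inp a (value inp st e) (value inp st f).
Proof. by []. Qed.

Lemma value_Terminal st T D G j : holds st T D G ->
  value inp st (Terminal j) = T (value inp st j).
Proof. by case=> hT _ _; rewrite -hT. Qed.

Lemma value_Climb st T D G j X : holds st T D G ->
  value inp st (Climb j X) = D (value inp st j) (value inp st X).
Proof. by case=> _ hD _; rewrite -hD. Qed.

Lemma value_Table st T D G X R : holds st T D G ->
  value inp st (Table X R) = G (value inp st X) (value inp st R).
Proof. by case=> _ _ hG; rewrite -hG. Qed.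

Lemma holds_memory st st' T D G : memory st' = memory st ->
  holds st T D G -> holds st' T D G.
Proof. by move=> e [hT hD hG]; split=> *; rewrite /cell e -?hT -?hD -?hG. Qed.

Let term := terminal inp.
Let up X := inp 3 X 0.
Let climbed (m j X : nat) : nat :=
  if j < m then climb inp t (inp 2 (term j) 0) X else 0.

Lemma climb_all_runs st : bounded B st -> regs st rS = s -> regs st rT = t ->
  holds st term zero2 zero2 ->
  runs inp B W climb_all st (s * (t * 100 + 100) + 6) (fun st' =>
    (forall z, z < 5 -> regs st' z = regs st z) /\
    holds st' term (climbed s) zero2).
Proof.
move=> bs eS eT hm.
pose I i st' := holds st' term (climbed i) zero2.
apply: (runs_for wd (I := I) (m := s) (T := t * 100 + 90)) => //.
- move=> i si lt_is bi xi fr ih.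
  have eTi : regs si rT = t by rewrite fr.
  apply: (runs_assign_seq wd (v := inp 2 (term i) 0) (T := t * 100 + 60)) => //.
  - by rewrite value_Inp (value_Terminal _ ih) /= xi.
  - exact: ltnW.
  - move=> b1; set b := inp 2 _ 0; set s1 := set_reg si rX b.
    have ih1 : holds s1 term (climbed i) zero2 by apply: holds_memory ih.
    apply: (runs_store_seq wd (a := addr 1 i b) (v := b.+1) (T := t * 100 + 10)) => //.
    - by rewrite /= /update /= xi.
    - by rewrite /= /update /= addn1.
    - exact: inpB.
    move=> b2.
    pose D c j X := if j == i then climb inp c b X else climbed i j X.
    have ih2 : holds (set_mem s1 (addr 1 i b) b.+1) term (D 0) zero2.
      apply: (holds_set1 ih1) => j X; rewrite /D /climbed.
      by case: (ltngtP j i) => //= ->; case: eqP.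
    move: b2 ih2; set s2 := set_mem s1 _ _ => b2 ih2.
    pose J c st' := regs st' rX = iter c up b /\ holds st' term (D c) zero2.
    have itB c : (iter c up b).+1 < B by case: c => [|c]; exact: inpB.
    apply: (runs_for wd (I := J) (m := t) (T := 90)) => //.
    + move=> c sc lt_ct bc xc frc [hX hc].
      have iI : regs sc rI = i by rewrite frc.
      apply: (runs_assign_seq wd (v := iter c.+1 up b) (T := 80)) => //.
      * by rewrite /= hX.
      * exact: ltnW.
      move=> b3; set s3 := set_reg sc _ _.
      have hc3 : holds s3 term (D c) zero2 by apply: holds_memory hc.
      have hX3 : regs s3 rX = iter c up b by [].
      have hQ3 : regs s3 rQ = iter c.+1 up b by [].
      have hI3 : regs s3 rI = i by [].
      apply: (runs_seq (T1 := 60) (T2 := 10) (Q1 := fun s4 =>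
         regs s4 = regs s3 /\ holds s4 term (D c.+1) zero2)) => //.
        have eD j X : D c.+1 j X = if (j == i) && (X == iter c.+1 up b) &&
          (climb inp c b (iter c.+1 up b) == 0) then (iter c up b).+1 else D c j X.
          rewrite /D; case: (j == i); rewrite ?andFb // andTb climbS.
          rewrite -[inp 3 _ 0]/(iter c.+1 up b).
          case: (X =P iter c.+1 up b) => [->|_] /=; last by case: eqP.
          by case: eqP.
        have eV : value inp s3 (Climb (Reg rI) (Reg rQ)) =
            climb inp c b (iter c.+1 up b).
          by rewrite (value_Climb _ _ hc3) /D [value _ _ (Reg rI)]hI3 eqxx.
        apply: (runs_if wd (T := 30)
          (b := climb inp c b (iter c.+1 up b) != 0)) => //;
          first (by rewrite eV); move=> cE.
          apply: runs_skip => //; split=> //; apply: eq_holds hc3 _ _ _ => // j X.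
          by rewrite eD (negbTE cE) andbF.
        apply: (runs_store wd (a := addr 1 i (iter c.+1 up b))
          (v := (iter c up b).+1)) => //.
        - by rewrite [LHS]/= /update /= iI.
        - by rewrite -[RHS]addn1 -hX3.
        split=> //; apply: (holds_set1 hc3) => j X.
        by rewrite eD (negbNE cE) andbT.
      move=> s4 b4 [r4 h4].
      apply: (runs_assign wd (v := iter c.+1 up b)) => //.
      * by rewrite -hQ3 -r4.
      * exact: ltnW.
    + move=> s' b' [_ h'] _; apply: eq_holds h' _ _ _ => // j X.
      by rewrite /D /climbed ltnS; case: ltngtP => // ->.
    + lia.
  - by rewrite /=; lia.
  - by rewrite /=; lia.
- move=> s' b' h' fr; split=> //.
  by move=> [|[|[|[|[|z]]]]] // _; exact: fr.
- lia.
Qed.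

Lemma value_Direction st T G j X : holds st T (climbed s) G ->
  value inp st j < s ->
  value inp st (Direction j X) = direction inp (value inp st j) (value inp st X).
Proof.
move=> h lt; rewrite !value_Bin (value_Climb _ _ h) /climbed lt value_Inp.
by [].
Qed.

Lemma value_Lab st D G j : holds st term D G ->
  value inp st (Lab (Terminal j)) = inp 5 (term (value inp st j)) 0.
Proof. by move=> h; rewrite value_Inp (value_Terminal _ h). Qed.

Lemma initialise_runs st : bounded B st -> regs st rS = s -> regs st rT = t ->
  holds st term (climbed s) zero2 ->
  runs inp B W initialise st (t * (s * (s * 138 + 130) + 60) + 6) (fun st' =>
    (forall z, z < 5 -> regs st' z = regs st z) /\
    holds st' term (climbed s) (reach inp 0)).
Proof.
move=> bs eS eT hm.
pose G i X R : nat := (X < i) && (R == mask (idle inp X) s).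
pose I i st' := holds st' term (climbed s) (G i).
apply: (runs_for wd (I := I) (m := t) (T := s * (s * 138 + 130) + 50)) => //.
- move=> X si lt_Xt bi xi fr ih.
  have eSi : regs si rS = s by rewrite fr.
  apply: (runs_assign_seq wd (v := 0) (T := s * (s * 138 + 130) + 40)) => //.
  move=> b1; set s1 := set_reg si _ _.
  apply: (runs_assign_seq wd (v := 1) (T := s * (s * 138 + 130) + 36)) => //.
  move=> b2; set s2 := set_reg s1 _ _.
  pose J j st' := [/\ regs st' rR = mask (idle inp X) j, regs st' rW = 2 ^ j &
    memory st' = memory si].
  apply: (runs_seq (T1 := s * (s * 138 + 128) + 6) (T2 := 30) (Q1 := fun s3 =>
    [/\ regs s3 rR = mask (idle inp X) s, regs s3 rX = X & memory s3 = memory si])).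
  + apply: (runs_for wd (I := J) (m := s) (T := s * 138 + 120)) => //.
    * move=> j sj lt_js bj xj frj [jR jW jM].
      have jX : regs sj rX = X by rewrite frj.
      have jS : regs sj rS = s by rewrite frj.
      have hj : holds sj term (climbed s) (G X) by apply: holds_memory ih.
      apply: (runs_assign_seq wd (v := direction inp j X == X) (T := s * 138 + 70)) => //.
      - by rewrite value_Bin (value_Direction _ hj) /= ?xj ?jX.
      - by case: (_ == _).
      move=> b3; set s3 := set_reg sj _ _.
      apply: (runs_assign_seq wd (v := 1) (T := s * 138 + 60)) => //.
      move=> b4; set s4 := set_reg s3 _ _.
      pose H k st' := regs st' rQ = ~~ some (separated inp j X) k /\
                      memory st' = memory si.
      apply: (runs_seq (T1 := s * 138 + 6) (T2 := 40) (Q1 := fun s5 =>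
        (forall z, z != rQ -> z != rK -> regs s5 z = regs s4 z) /\ H s s5)).
      - apply: (runs_for wd (I := H) (m := s) (T := 130)) => //.
        + move=> k sk lt_ks bk xk frk [kQ kM].
          have hk : holds sk term (climbed s) (G X) by apply: holds_memory ih.
          have kJ : regs sk rJ = j by rewrite frk.
          have kX : regs sk rX = X by rewrite frk.
          apply: (runs_if wd (T := 3) (b := separated inp j X k)) => //.
          * rewrite -[value _ _ _]/((value inp sk (Lab (Terminal (Reg rJ))) ==
                value inp sk (Lab (Terminal (Reg rK)))) *
              (1 - (value inp sk (Direction (Reg rJ) (Reg rX)) ==
                value inp sk (Direction (Reg rK) (Reg rX)))))
              !(value_Lab _ hk) !(value_Direction _ hk) /= ?xk ?kJ ?kX //.
            by rewrite /separated -/term; case: (inp 5 _ _ == _);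
               case: (direction _ _ _ == _).
          * move=> c; apply: (runs_assign wd (v := 0)) => //; split=> //=.
            by rewrite /update /= c orbT.
          * move=> c; apply: runs_skip => //; split=> //=.
            by rewrite /update /= kQ (negbTE c) orbF.
        + move=> s' b' [h1 h2] fr'; split=> // z z1 z2; apply: fr'.
          by rewrite /= !inE negb_or z1 z2.
      - move=> s5 b5 [fr5 [q5 m5]].
        apply: (runs_seq (T1 := 20) (T2 := 10) (Q1 := fun s6 =>
          [/\ regs s6 rR = mask (idle inp X) j.+1, regs s6 rW = 2 ^ j &
              memory s6 = memory si])) => //.
          have c5 : regs s5 rC = (direction inp j X == X) by rewrite fr5.
          have r5 : regs s5 rR = mask (idle inp X) j by rewrite fr5.
          have w5 : regs s5 rW = 2 ^ j by rewrite fr5.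
          apply: (runs_if wd (T := 5) (b := idle inp X j)) => //.
          - by rewrite /= c5 q5 /idle; case: (_ == X); case: (some _ _).
          - move=> c; have e6 : regs s5 rR + regs s5 rW = mask (idle inp X) j.+1.
              by rewrite r5 w5 /= c mul1n.
            apply: (runs_assign wd (v := mask (idle inp X) j.+1)) => //.
            apply: leq_ltn_trans PB; apply: ltnW; apply: leq_trans (mask_lt _ _) _.
            by rewrite leq_exp2l.
          - move=> c; apply: runs_skip => //; split=> //.
            by rewrite r5 /= (negbTE c) addn0.
        move=> s6 b6 [r6 w6 m6].
        apply: (runs_assign wd (v := 2 ^ j.+1)) => //=.
        - by rewrite w6 expnS mul2n addnn.
        - by apply: leq_ltn_trans PB; rewrite leq_exp2l.
      - lia.
      - rewrite /=; lia.
      - rewrite /=; lia.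
    * by move=> s' b' [h1 h2 h3] fr'; split=> //; rewrite fr'.
    * lia.
  + move=> s3 b3 [r3 x3 m3].
    apply: (runs_store wd (a := addr 2 X (mask (idle inp X) s)) (v := 1)) => //.
    * by rewrite /= r3 x3.
    apply: (@holds_set2 s3 term (climbed s) (G X)).
      exact: (holds_memory m3 ih).
    move=> Y R; rewrite /G ltnS; case: ltngtP => //= ->; by case: eqP.
  + lia.
  + rewrite /=; lia.
  + rewrite /=; lia.
- move=> s' b' h' fr; split=> //.
  by move=> [|[|[|[|[|z]]]]] // _; exact: fr.
- lia.
Qed.


Lemma serve_runs st G v x j R : bounded B st ->
  [/\ regs st rS = s, regs st rI = v, regs st rX = x, regs st rK = j
    & regs st rR = R] ->
  x = inp 2 v 0 -> j < s ->
  holds st term (climbed s) G ->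
  runs inp B W serve st (s * 118 + 50) (fun st' =>
    (forall z, z < 10 -> regs st' z = regs st z) /\
    holds st' term (climbed s) (fun Y R' =>
      if (Y == x) && (R' == served inp v j R) then 1 else G Y R')).
Proof.
move=> bs [eS eI eX eK eR] xv js hm.
apply: (runs_assign_seq wd (v := 0) (T := s * 118 + 40)) => //
  [b1|]; last by rewrite /=; lia.
apply: (runs_assign_seq wd (v := 1) (T := s * 118 + 36)) => //
  [b2|]; last by rewrite /=; lia.
set s2 := set_reg _ rW 1.
pose f j' := serves inp v j j' || bit R j'.
pose J q st' := [/\ regs st' rC = mask f q, regs st' rW = 2 ^ q
  & memory st' = memory st].
apply: (runs_seq (T1 := s * 118 + 6) (T2 := 30) (Q1 := fun s3 =>
    [/\ forall z, z < 10 -> regs s3 z = regs st z, regs s3 rC = mask f s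
      & memory s3 = memory st])).
- apply: (runs_for wd (I := J) (m := s) (T := 110)) => //.
  + move=> q sq lt_qs bq xq frq [qC qW qM].
    have hq : holds sq term (climbed s) G by apply: holds_memory hm.
    have qK : regs sq rK = j by rewrite frq.
    have qI : regs sq rI = v by rewrite frq.
    have qX : regs sq rX = x by rewrite frq.
    have qR : regs sq rR = R by rewrite frq.
    apply: (runs_seq (T1 := 100) (T2 := 10) (Q1 := fun s6 =>
          [/\ regs s6 rC = mask f q.+1, regs s6 rW = 2 ^ q &
              memory s6 = memory st])) => //.
      apply: (runs_if wd (T := 5) (b := f q)) => //.
      * rewrite -[value _ _ _]/((value inp sq (Lab (Terminal (Reg rQ))) ==
             value inp sq (Lab (Terminal (Reg rK)))) *
           inp 4 (regs sq rI) (value inp sq (Direction (Reg rQ) (Reg rX))) +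
           (regs sq rR %/ regs sq rW) %% 2).
        rewrite !(value_Lab _ hq) !(value_Direction _ hq) /= ?xq //.
        rewrite qK qI qX qR qW modn2 -/(bit R q) /f /serves -/term xv.
        case: (inp 5 _ _ == _); rewrite ?mul1n ?mul0n /=; last by case: (bit R q).
        by rewrite addn_eq0 negb_and eqb0 negbK.
      * move=> c; have e6 : regs sq rC + regs sq rW = mask f q.+1.
          by rewrite qC qW /= c mul1n.
        apply: (runs_assign wd (v := mask f q.+1)) => //.
        apply: leq_ltn_trans PB; apply: ltnW; apply: leq_trans (mask_lt _ _) _.
        by rewrite leq_exp2l.
      * move=> c; apply: runs_skip => //; split=> //.
        by rewrite qC /= (negbTE c) addn0.
    move=> s6 b6 [r6 w6 m6].
    apply: (runs_assign wd (v := 2 ^ q.+1)) => //=.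
    * by rewrite w6 expnS mul2n addnn.
    * by apply: leq_ltn_trans PB; rewrite leq_exp2l.
  + move=> s' b' [h1 h2 h3] fr'; split=> //.
    by do 10![case=> [_|]; first exact: fr'].
- move=> s3 b3 [r3 c3 m3].
  apply: (runs_store wd (a := addr 2 x (mask f s)) (v := 1)) => //.
    by rewrite /= c3 r3 // eX.
  split=> //.
  by apply: (@holds_set2 s3 term (climbed s) G); first exact: (holds_memory m3 hm).
- lia.
Qed.

Lemma sweep_runs st : bounded B st -> regs st rN = n -> regs st rS = s ->
  regs st rT = t -> regs st rP = 2 ^ s ->
  holds st term (climbed s) (reach inp 0) ->
  runs inp B W sweep st (n * (2 ^ s * (s * (s * 118 + 120) + 60) + 20) + 6)
    (fun st' =>
    (forall z, z < 5 -> regs st' z = regs st z) /\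
    holds st' term (climbed s) (reach inp n)).
Proof.
move=> bs eN eS eT eP hm.
pose I i st' := holds st' term (climbed s) (reach inp i).
apply: (runs_for wd (I := I) (m := n)
  (T := 2 ^ s * (s * (s * 118 + 120) + 60) + 12)) => //.
- move=> v sv lt_vn bv xv frv hv.
  have vS : regs sv rS = s by rewrite frv.
  have vP : regs sv rP = 2 ^ s by rewrite frv.
  set x := inp 2 v 0.
  apply: (runs_assign_seq wd (v := x)
    (T := 2 ^ s * (s * (s * 118 + 120) + 60) + 6)) => //.
  - by rewrite /= xv.
  - by apply: ltnW; exact: inpB.
  move=> b1; set s1 := set_reg sv _ _.
  pose added R0 m R :=
    some (fun j => joinable inp v j && (R == served inp v j R0)) m.
  pose past c R := some (fun d =>
    reach inp v x (2 ^ s - d.+1) && added (2 ^ s - d.+1) s R) c.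
  pose G c Y R := reach inp v Y R || (Y == x) && past c R.
  pose J c st' := holds st' term (climbed s) (G c).
  apply: (runs_for wd (I := J) (m := 2 ^ s) (T := s * (s * 118 + 120) + 50)) => //.
  + apply: eq_holds hv _ _ _ => // Y R.
    by rewrite /G /= andbF orbF.
  + move=> c sc lt_c bc xc frc hc.
    have cP : regs sc rP = 2 ^ s by rewrite frc.
    have cS : regs sc rS = s by rewrite frc.
    have cX : regs sc rX = x by rewrite frc.
    have cI : regs sc rI = v by rewrite frc.
    set R := 2 ^ s - c.+1.
    have RP : R < 2 ^ s by rewrite /R; lia.
    apply: (runs_assign_seq wd (v := R) (T := s * (s * 118 + 120) + 40)) => //.
    * by rewrite /= cP xc addn1.
    * exact: ltn_trans PB.
    move=> b2; set s2 := set_reg sc _ _.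
    have h2 : holds s2 term (climbed s) (G c) by apply: holds_memory hc.
    (* entry [R] is still untouched: an entry written so far is at least as
       large a number as a subset scanned before, hence larger than [R] *)
    have GR : G c x R = reach inp v x R.
      rewrite /G eqxx /=; case E: (past c R); rewrite ?orbF //.
      case/someP: E => d lt_dc /andP[_ /someP[j _ /andP[_ /eqP]]] E.
      have := @served_ge inp v j (2 ^ s - d.+1); rewrite -/s -E => H.
      by exfalso; move: H; rewrite /R; lia.
    apply: (runs_if wd (T := s * (s * 118 + 120) + 10) (b := reach inp v x R)) => //.
    * rewrite (value_Table _ _ h2) -GR -[X in G c X]/(regs s2 rX) /= /update /= cX.
      by case: (G c x R).
    * move=> reR.
      pose H k st' := holds st' term (climbed s) (fun Y R' =>
        G c Y R' || (Y == x) && added R k R').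
      apply: (runs_for wd (I := H) (m := s) (T := s * 118 + 110)) => //.
      - by apply: eq_holds h2 _ _ _ => // Y R'; rewrite andbF orbF.
      - move=> k sk lt_ks bk xk frk hk.
        have kX : regs sk rX = x by rewrite frk.
        have kI : regs sk rI = v by rewrite frk.
        have kS : regs sk rS = s by rewrite frk.
        have kR : regs sk rR = R by rewrite frk.
        apply: (runs_if wd (T := s * 118 + 50) (b := joinable inp v k)) => //.
        + rewrite -[value _ _ _]/(inp 6 (value inp sk (Lab (Terminal (Reg rK))) - 1)
              (regs sk rI) *
            ((inp 5 (regs sk rI) 0 == 0) +
             (inp 5 (regs sk rI) 0 == value inp sk (Lab (Terminal (Reg rK)))))).
          rewrite !(value_Lab _ hk) /= xk kI subn1 /joinable -/term muln_eq0 negb_or.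
          by congr (_ && _); rewrite addn_eq0 negb_and !eqb0 !negbK.
        + move=> jk; apply: runs_weaken
            (serve_runs (v := v) (x := x) (j := k) (R := R) bk _ _ lt_ks hk)
            _ _ => //.
          move=> s' b' [_ h']; apply: eq_holds h' _ _ _ => // Y R'.
          rewrite /added /= jk /=; case: (Y == x) => //=.
          by case: (R' == _); rewrite ?orbT ?orbF.
        + move=> jk; apply: runs_skip => //; first lia.
          apply: eq_holds hk _ _ _ => // Y R'.
          by rewrite /added /= (negbTE jk) orbF.
        + rewrite /=; lia.
      - move=> s' b' h' _; apply: eq_holds h' _ _ _ => // Y R'.
        rewrite /G /past /= -/R -/(past c R') reR /=.
        case: (Y == x); rewrite ?orbF //=.
        by rewrite -orbA.
      - lia.
    * move=> reR; apply: runs_skip => //; first lia.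
      apply: eq_holds h2 _ _ _ => // Y R'.
      by rewrite /G /past /= -/R (negbTE reR) orbF.
    * rewrite /=; lia.
    * rewrite /=; lia.
  + move=> s' b' h' _; apply: eq_holds h' _ _ _ => // Y R.
    (* scanning downwards visits the same subsets *)
    rewrite /G /= -/x -/s; case: (Y =P x) => [->|//] /=.
    congr (nat_of_bool (_ || _)).
    apply/someP/someP => -[d lt_d /andP[H1 H2]].
      exists (2 ^ s - d.+1); first by lia.
      by rewrite H1.
    exists (2 ^ s - d.+1); first by lia.
    have -> : 2 ^ s - (2 ^ s - d.+1).+1 = d by lia.
    by rewrite H1.
  + lia.
  rewrite /=; lia.
- move=> s' b' h' fr; split=> //.
  by move=> [|[|[|[|[|z]]]]] // _; exact: fr.
- lia.
Qed.

Lemma verdict_runs st : bounded B st -> regs st rT = t -> regs st rP = 2 ^ s ->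
  regs st rOut = every (in_domain inp) n ->
  holds st term (climbed s) (reach inp n) ->
  runs inp B W verdict st (t * 60 + 6) (fun st' => regs st' rOut = answer inp).
Proof.
move=> bs eT eP eO hm.
pose full X := reach inp n X (2 ^ s - 1).
pose I i st' := regs st' rOut = every (in_domain inp) n && every full i /\
  memory st' = memory st.
apply: (runs_for wd (I := I) (m := t) (T := 50)) => //.
- by rewrite /I /= andbT.
- move=> X si lt_X bi xi fr [iO iM].
  have hi : holds si term (climbed s) (reach inp n) by apply: holds_memory hm.
  have iP : regs si rP = 2 ^ s by rewrite fr.
  apply: (runs_if wd (T := 5) (b := full X)) => //.
  + by rewrite (value_Table _ _ hi) /= xi iP -/(full X); case: (full X).
  + move=> c; apply: runs_skip => //; split=> //.
    by rewrite /= /update /= iO c andbT.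
  + move=> c; apply: (runs_assign wd (v := 0)) => //; split=> //.
    by rewrite /= (negbTE c) !andbF.
- by move=> s' b' [h1 h2] _.
- lia.
Qed.

(** The phases cost at most, up to constants, n, s * t, t * s^2, n * 2^s * s^2
    and t. *)
Lemma program_runs : t <= n ->
  runs inp B W program init_state
    (n * (2 ^ s * (s * s * 300 + s * 400 + 600)) + 100)
    (fun st' => regs st' rOut = answer inp).
Proof.
move=> tn.
have P1 : 0 < 2 ^ s by rewrite expn_gt0.
have nP : n <= n * 2 ^ s by rewrite leq_pmulr.
have nPs : n * s <= n * 2 ^ s * s by rewrite leq_mul.
have nPss : n * s * s <= n * 2 ^ s * s * s by rewrite leq_mul.
have ts : t * s <= n * s by rewrite leq_mul.
have tss : t * s * s <= n * s * s by rewrite leq_mul.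
apply: (runs_assign_seq wd (v := n)
  (T := n * (2 ^ s * (s * s * 300 + s * 400 + 600)) + 90)) => //.
move=> b1; set s1 := set_reg _ _ _.
apply: (runs_assign_seq wd (v := t)
  (T := n * (2 ^ s * (s * s * 300 + s * 400 + 600)) + 80)) => //.
move=> b2; set s2 := set_reg _ _ _.
apply: (runs_assign_seq wd (v := 1)
  (T := n * (2 ^ s * (s * s * 300 + s * 400 + 600)) + 70)) => //.
move=> b3; set s3 := set_reg _ _ _.
apply: (runs_assign_seq wd (v := 1)
  (T := n * (2 ^ s * (s * s * 300 + s * 400 + 600)) + 60)) => //.
move=> b4; set s4 := set_reg _ _ _.
apply: (runs_seq (T2 := n * (2 ^ s * (s * s * 300 + s * 400 + 400)) + 50)
  (collect_runs b4 _ _ _ _ _)) => //.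
move=> s5 b5 [r3 r4 r1 r2 [r0 h5]].
apply: (runs_seq (T2 := n * (2 ^ s * (s * s * 260 + s * 260 + 220)) + 40)
  (climb_all_runs b5 r3 r2 h5)) => //.
move=> s6 b6 [fr6 h6].
apply: (runs_seq (T2 := n * (2 ^ s * (s * s * 120 + s * 130 + 140)) + 30)
  (initialise_runs b6 _ _ h6)); rewrite ?fr6 //.
move=> s7 b7 [fr7 h7].
apply: (runs_seq (T2 := n * 60 + 6)
  (sweep_runs b7 _ _ _ _ h7)); rewrite ?fr7 ?fr6 //.
move=> s8 b8 [fr8 h8].
apply: runs_weaken (verdict_runs b8 _ _ _ h8) _ _; rewrite ?fr8 ?fr7 ?fr6 //.
all: rewrite /=; lia.
Qed.

End Verification.

(** * Re-rooting a tree given by its parent function *)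

(** [toward b] is the parent function of the same tree rooted at [b]. *)
Section Rerooting.

Variables (I : finType) (par : I -> I) (r : I).
Hypotheses (par_r : par r = r) (to_root : forall X, fconnect par X r).

(** Induction on the depth of a node. *)
Lemma root_ind (Q : I -> Prop) :
  Q r -> (forall b, b != r -> Q (par b) -> Q b) -> forall b, Q b.
Proof.
move=> Qr step b; have := iter_findex (to_root b); move: (findex _ _ _) => m.
elim: m b => [|m IH] b; first by move=> /= ->.
have [-> //|nb] := eqVneq b r.
by rewrite iterSr => /IH; apply: step.
Qed.

(** The only cycle of the parent function is the loop at the root: iterates of a
    node on a 2-cycle never leave it, yet one of them is the root. *)
Lemma par_par X : par (par X) = X -> X = r.
Proof.
move=> e; 
suff H m : iter m par X = X \/ iter m par X = par X.
  have [] := H (findex par X r); rewrite iter_findex // => eX //.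
  by rewrite -e -eX par_r.
elim: m => [|m [IH|IH]]; first by left.
  by right; rewrite iterS IH.
by left; rewrite iterS IH e.
Qed.

Lemma par_neq X : X != r -> par X != X.
Proof. by apply: contraNneq => e; apply/eqP/par_par; rewrite !e. Qed.

Definition tree_adj (X Y : I) : bool :=
  (X != Y) && ((par X == Y) || (par Y == X)).

Lemma tree_adjC X Y : tree_adj X Y = tree_adj Y X.
Proof. by rewrite /tree_adj eq_sym orbC. Qed.

Lemma tree_adj_par X : X != r -> tree_adj X (par X).
Proof. by move=> Xr; rewrite /tree_adj eqxx eq_sym par_neq. Qed.

(** The climb from [b] is cut off after [m] steps; once the root is reached,
    further steps change nothing ([toward_fuelS]). *)
Fixpoint toward_fuel (m : nat) (b X : I) : I :=
  if X == b then b else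
  if m is m'.+1 then (if X == par b then b else toward_fuel m' (par b) X)
  else par X.

Definition toward (b X : I) : I := toward_fuel #|I| b X.

Lemma toward_fuelS m b X : iter m par b = r ->
  toward_fuel m.+1 b X = toward_fuel m b X.
Proof.
elim: m b => [|m IH] b.
  by move=> /= ->; rewrite par_r; case: eqP.
rewrite iterSr => /IH e.
rewrite -[LHS]/(if X == b then b else if X == par b then b
  else toward_fuel m.+1 (par b) X) e //.
Qed.

Lemma toward_fuelE m b X : #|I| <= m -> toward_fuel m b X = toward b X.
Proof.
move=> /subnKC <-; elim: (m - _) => [|d IH]; first by rewrite addn0.
rewrite addnS toward_fuelS // -(iter_findex (to_root b)).
have lt := findex_max (to_root b).
have {}lt : findex par b r <= #|I| + d.
  by apply: leq_trans (ltnW lt) _; apply: leq_trans (max_card _) (leq_addr _ _).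
rewrite -(subnK lt) iterD iter_findex //.
by elim: (_ - _) => //= e ->.
Qed.

(** Moving the root from the parent of [b] to [b] only reverses the edge between
    them.  With induction on the depth, this is the source of all the facts
    below. *)
Lemma toward_rec b X :
  toward b X = if (X == b) || (X == par b) then b else toward (par b) X.
Proof.
rewrite -(@toward_fuelE #|I|.+1) //=.
by case: (X == b).
Qed.

Lemma toward_root X : toward r X = par X.
Proof.
rewrite /toward; case: #|I| => [|m] /=; first by case: eqP => // ->.
case: eqP => [->|/eqP Xr] //; rewrite par_r (negbTE Xr).
by elim: m => [|m IH] /=; rewrite ?par_r (negbTE Xr).
Qed.

Lemma toward_self b : toward b b = b.
Proof. by rewrite toward_rec eqxx. Qed.

Lemma toward_adj b X : X != b -> tree_adj X (toward b X).
Proof.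
elim/root_ind: b X => [X Xr|b br IH X Xb].
  by rewrite toward_root tree_adj_par.
rewrite toward_rec (negbTE Xb) /=; case: eqVneq => [->|/IH //].
by rewrite tree_adjC tree_adj_par.
Qed.

(** A tree edge points towards [b] from exactly one of its ends. *)
Lemma toward_edge b X Y : tree_adj X Y ->
  (toward b X == Y) = (toward b Y != X).
Proof.
elim/root_ind: b X Y => [X Y|b br IH X Y aXY].
  rewrite !toward_root /tree_adj => /andP[XY].
  case: (par X =P Y) => [eX _|_ /= -> //]; apply/esym; apply: contra XY => /eqP eY.
  have Xr : X = r by apply: par_par; rewrite eX.
  by rewrite -eX Xr par_r.
have nbr Z : tree_adj Z (par b) -> toward (par b) Z = par b.
  move=> aZ; apply/eqP; rewrite (IH _ _ aZ) toward_self eq_sym.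
  by case/andP: aZ.
have nb : toward (par b) b = par b by apply/nbr/tree_adj_par.
have [XY _] := andP aXY; rewrite [toward b X]toward_rec [toward b Y]toward_rec.
have [Xb|Xb] /= := eqVneq X b.
  rewrite {X}Xb in XY aXY *; rewrite (negbTE XY) [Y == b]eq_sym (negbTE XY) /=.
  case: (eqVneq Y (par b)) => [_|Yp]; first by rewrite eqxx.
  by rewrite -(IH _ _ aXY) nb eq_sym (negbTE Yp).
have [Xp|Xp] := eqVneq X (par b).
  have [->|Yb] /= := eqVneq Y b; first by rewrite eq_sym Xb.
  have eY : toward (par b) Y = par b by apply: nbr; rewrite -Xp tree_adjC.
  by rewrite eY -Xp [Y == X]eq_sym (negbTE XY) eqxx.
have [Yb|Yb] /= := eqVneq Y b.
  by rewrite (IH _ _ aXY) Yb nb [b == X]eq_sym Xb eq_sym Xp.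
have [Yp|Yp] := eqVneq Y (par b); last exact: IH.
by rewrite nbr -?Yp // Yp eqxx eq_sym Xb.
Qed.

Lemma toward_nbr X Y : tree_adj X Y -> toward Y X = Y.
Proof.
move=> a; apply/eqP; rewrite (toward_edge _ a) toward_self eq_sym.
by case/andP: a.
Qed.

(** A target that moves along a tree edge changes its direction only from the two
    ends of that edge. *)
Lemma toward_move Z Z' X : tree_adj Z Z' -> toward Z X != toward Z' X ->
  X = Z \/ X = Z'.
Proof.
have step b : toward b X != toward (par b) X -> X = b \/ X = par b.
  rewrite toward_rec; case: (X =P b) => [|_] /=; first by left.
  by case: (X =P par b) => [|_]; [right|rewrite eqxx].
case/andP=> _ /orP[] /eqP<-; first exact: step.
by rewrite eq_sym => /step[]; [right|left].
Qed.

(** Up to the first visit to [b] or to its parent, the paths towards [b] and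
    towards the parent of [b] coincide. *)
Lemma toward_reach b X : exists m, iter m (toward b) X = b.
Proof.
elim/root_ind: b X => [X|b br IH X].
  exists (findex par X r); rewrite -[RHS](iter_findex (to_root X)).
  by apply: eq_iter => Y; rewrite toward_root.
have [m] := IH X; elim: m X => [|m IHm] X.
  by move=> /= ->; exists 1; rewrite /= toward_rec eqxx orbT.
have [Xb|Xb] := eqVneq X b; first by exists 0.
have [Xp|Xp] := eqVneq X (par b).
  by exists 1; rewrite /= toward_rec Xp eqxx orbT.
rewrite iterSr => /IHm[m' e]; exists m'.+1.
by rewrite iterSr [toward b X]toward_rec (negbTE Xb) (negbTE Xp).
Qed.

End Rerooting.

(** * Reduction to independent problems in the bags *)

Section LocalSearch.

Variables (I V : finType) (par : I -> I) (r : I).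
Hypotheses (par_r : par r = r) (to_root : forall X, fconnect par X r).
Variables (G : sgraph V) (bag : V -> I).

Let adjacent := tree_adj par.
Let toward_bag (w : V) : I -> I := toward par (bag w).

Definition boundary (v : V) (Y : I) : bool :=
  (bag v != Y) && [exists w, (bag w == Y) && G v w].

Hypotheses (clique : forall u v, bag u = bag v -> u != v -> G u v)
  (edge_bags : forall u v, G u v -> bag u = bag v \/ adjacent (bag u) (bag v))
  (boundary_edge : forall u v,
     boundary u (bag v) -> boundary v (bag u) -> G u v).

Variables (k : nat) (S U : 'I_k -> {set V}).
Hypothesis Sdisj : forall i j : 'I_k, i != j -> [disjoint S i & S j].

Definition needed (l : 'I_k) (X : I) (w : V) : bool :=
  (toward_bag w X != X) && [exists w' in S l, toward_bag w' X != toward_bag w X].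

(** A vertex is chosen for at most one index because [f] is a function. *)
Definition local_choice (f : V -> option 'I_k) : Prop :=
  (forall v l, f v = Some l -> v \in U l /\ forall l', v \in S l' -> l' = l) /\
  (forall l w X, w \in S l -> needed l X w ->
     exists v, [/\ bag v = X, f v = Some l & boundary v (toward_bag w X)]).

Lemma connect_cross (e : rel V) (p : pred V) x y :
  connect e x y -> ~~ p x -> p y -> exists u v, [/\ e u v, ~~ p u & p v].
Proof.
case/connectP=> q + ->; elim: q x => [x _ /negbTE -> //|z q IH x] /=.
case/andP=> exz pz px ply; have [pz'|npz] := boolP (p z); first by exists x, z.
exact: IH pz npz ply.
Qed.

(** A path of F_l from a terminal in another direction to [w] contains an edge of
    G along which the direction as seen from [X] changes to that of [w].  By
    [toward_move] it leads from [X] to the next bag towards [w]. *)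
Lemma choice_of_subgraphs : srdcs G S U -> exists f, local_choice f.
Proof.
case=> F [conn disj dom].
have uniq_l v l l' : v \in sub_verts (F l) -> v \in sub_verts (F l') -> l' = l.
  move=> vl vl'; apply: contraTeq vl => ne.
  have := disj _ _ ne; rewrite disjoint_subset => /subsetP/(_ _ vl').
  by rewrite inE.
pose f v := [pick l | v \in sub_verts (F l)].
have fE v l : v \in sub_verts (F l) -> f v = Some l.
  rewrite /f => vl; case: pickP => [l' vl'|/(_ l)]; last by rewrite vl.
  by rewrite (uniq_l _ _ _ vl vl').
exists f; split=> [v l|l w X wl].
  rewrite /f; case: pickP => // l1 vl [<-].
  split; first exact: (subsetP (dom l1).2).
  by move=> l' /(subsetP (dom l').1); apply: uniq_l.
case/andP=> YX /exists_inP[w' w'l ne].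
set Y := toward_bag w X in YX ne *.
have [wF w'F] : w \in sub_verts (F l) /\ w' \in sub_verts (F l).
  by split; apply: (subsetP (dom l).1).
have [u [v [/sub_edgeP[uF vF Guv] nu /eqP ev]]] :=
  connect_cross (p := fun v => toward_bag v X == Y) (conn l _ _ w'F wF) ne (eqxx Y).
have bne : bag u <> bag v.
  by move=> e; move: nu; rewrite /toward_bag e -/(toward_bag v X) ev eqxx.
have [//|a] := edge_bags Guv.
have [|eX|eX] := toward_move (X := X) par_r to_root a.
- by rewrite -/(toward_bag v X) ev.
- have eY : Y = bag v by rewrite -ev eX; exact: (toward_nbr par_r to_root a).
  exists u; split; [by rewrite eX|exact: fE|].
  rewrite /boundary eY; apply/andP; split; first by apply/eqP.
  by apply/existsP; exists v; rewrite eqxx.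
- by move: YX; rewrite -ev eX /toward_bag (toward_self par_r to_root) eqxx.
Qed.

(** F_l is induced by S_l and by the vertices chosen for l in the bags that have
    a requirement of S_l.  In a bag that meets F_l, every direction towards a
    terminal of S_l outside the bag is required, so there is a chosen vertex in the boundary towards the next
    bag; the next bag has a requirement back, and so a chosen vertex in the
    opposite boundary.  The two are adjacent, and one is a bag closer to the
    terminal. *)
Lemma subgraphs_of_choice f : (forall l, S l \subset U l) -> local_choice f ->
  srdcs G S U.
Proof.
move=> SU [fdom fneed].
pose chosen l v := (f v == Some l) && [exists w in S l, needed l (bag v) w].
pose A l := [set v | (v \in S l) || chosen l v].
pose e l u v := [&& u \in A l, v \in A l & G u v].
have e_sym l : symmetric (e l) by move=> u v; rewrite /e adj_sym andbCA.
have eP l x y : e l x y -> [/\ x \in A l, y \in A l & G x y] by case/and3P.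
pose F l := Subgraph (e_sym l) (@eP l).
have same l u v : u \in A l -> v \in A l -> bag u = bag v -> connect (e l) u v.
  move=> uA vA b; have [->|ne] := eqVneq u v; first exact: connect0.
  by apply: connect1; rewrite /e uA vA clique.
have toA l v X w :
    w \in S l -> needed l X w -> bag v = X -> f v = Some l -> v \in A l.
  move=> wl nd b fv; rewrite inE /chosen fv eqxx b; apply/orP; right.
  by apply/exists_inP; exists w.
have main l w v : w \in S l -> v \in A l -> connect (e l) v w.
  move=> wl; have wA : w \in A l by rewrite inE wl.
  have [m] := toward_reach par_r to_root (bag w) (bag v).
  elim: m v => [|m IH] v; first by move=> b vA; apply: same.
  have [b _ vA|Xw] := eqVneq (bag v) (bag w); first exact: same.
  set X := bag v in Xw *; set Y := toward par (bag w) X.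
  rewrite iterSr -/Y => itY vA.
  have aXY : adjacent X Y by apply: (toward_adj par_r to_root).
  have YX : Y != X by case/andP: aXY; rewrite eq_sym.
  have nX : needed l X w.
    apply/andP; split=> //; apply: contraTT vA => /exists_inPn H.
    have {}H w' : w' \in S l -> toward_bag w' X = Y by move/H/negPn/eqP.
    rewrite inE negb_or; apply/andP; split.
      by apply: contra YX => /H <-; rewrite /toward_bag (toward_self par_r to_root).
    apply/negP => /andP[_ /exists_inP[w0 w0l /andP[_ /exists_inP[w1 w1l]]]].
    by rewrite -/X !H ?eqxx.
  have [u [bu fu du]] := fneed _ _ _ wl nX.
  have uA := toA _ _ _ _ wl nX bu fu.
  have /andP[_ /exists_inP[w' w'l nw']] := nX.
  have ew' : toward_bag w' Y = X.
    by apply/eqP; move: nw'; rewrite (toward_edge par_r to_root _ aXY) negbK.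
  (* the terminal [w'] that makes the requirement at [X] also makes, in the
     direction back to [X], a requirement at [Y] *)
  have nY : needed l Y w'.
    rewrite /needed ew' eq_sym YX; apply/exists_inP; exists w => //.
    by rewrite -(toward_edge par_r to_root _ aXY).
  have [u' [bu' fu' du']] := fneed _ _ _ w'l nY.
  have u'A := toA _ _ _ _ w'l nY bu' fu'.
  rewrite ew' in du'.
  apply: connect_trans (same l v u vA uA _) _ => //.
  apply: connect_trans (connect1 _) (IH u' _ u'A); last by rewrite bu'.
  by rewrite /e uA u'A boundary_edge // ?bu ?bu'.
exists F; split=> [l x y xA yA|l l' ll'|l].
- have [w wl] : exists w, w \in S l.
    move: xA; rewrite inE => /orP[xl|/andP[_ /exists_inP[w wl _]]]; last by exists w.
    by exists x.
  apply: connect_trans (main _ _ _ wl xA) _.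
  by rewrite (sym_connect_sym (e_sym l)) (main _ _ _ wl).
- rewrite disjoint_subset; apply/subsetP => v; rewrite !inE => vl.
  apply: contra ll' => vl'; apply/eqP.
  have [vS|/andP[/eqP fv _]] := orP vl; have [vS'|/andP[/eqP fv' _]] := orP vl'.
  + apply/eqP; apply: contraTT vS => ne; apply: contraTN vS' => vS.
    by have := Sdisj ne; rewrite disjoint_subset => /subsetP/(_ _ vS); rewrite inE.
  + by case: (fdom _ _ fv') => _ /(_ _ vS).
  + by case: (fdom _ _ fv) => _ /(_ _ vS').
  + by move: fv; rewrite fv' => -[].
- split; apply/subsetP => v; rewrite inE; first by move=> ->.
  by case/orP => [/(subsetP (SU l))|/andP[/eqP/fdom[]]].
Qed.

End LocalSearch.

(** * Correctness of the dynamic program *)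

Section DynamicProgram.

Variable inp : nat -> nat -> nat -> nat.
Let n := inp 0 0 0.
Let t := inp 0 1 0.
Let s := size (terminals inp).

(** A choice sends a vertex to a terminal of the set that it joins. *)
Definition valid_choice (c : nat -> option nat) : Prop :=
  forall v j, c v = Some j -> j < s /\ joinable inp v j.

Definition satisfied (c : nat -> option nat) (i X j' : nat) : Prop :=
  idle inp X j' \/
  exists v j, [/\ v < i, inp 2 v 0 = X, c v = Some j & serves inp v j j'].

Lemma reach_sound i X R : reach inp i X R ->
  exists c, valid_choice c /\ forall j, j < s -> bit R j -> satisfied c i X j.
Proof.
elim: i R => [|v IH] R /=.
  case/andP=> _ /eqP ->; exists (fun=> None); split=> // j js.
  by rewrite bit_mask js => ?; left.
case/orP=> [/IH[c [cv cR]]|/andP[/eqP Xv /someP[R0 _ /andP[/IH[c [cv cR]] ]]]].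
  exists c; split=> // j js /(cR _ js)[|[u [j0 [uv bu cu su]]]]; first by left.
  by right; exists u, j0; split=> //; lia.
case/someP=> j0 j0s /andP[vj0 /eqP eR].
exists (fun u => if u == v then Some j0 else c u); split=> [u j|j js].
  by case: eqP => [-> [<-]|_ /cv].
rewrite eR bit_mask js /= => /orP[sv|/(cR _ js)[|[u [j1 [uv bu cu su]]]]].
- by right; exists v, j0; rewrite eqxx; split.
- by left.
- right; exists u, j1; split=> //; first by lia.
  by case: eqP uv => // ->; rewrite ltnn.
Qed.

(** The subset that the table reaches by following [c] may contain more than the
    requirements satisfied by [c], because of the idle ones and of earlier
    vertices; containment is what the final test needs. *)
Lemma reach_complete c i X : valid_choice c -> X < t ->
  exists R, [/\ reach inp i X R, R < 2 ^ s
    & forall j, j < s -> satisfied c i X j -> bit R j].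
Proof.
move=> cv Xt; elim: i => [|v [R [rR Rs bR]]].
  exists (mask (idle inp X) s); split; [by rewrite /= Xt eqxx|exact: mask_lt|].
  by move=> j js [ij|[v [j0 []]]] //; rewrite bit_mask js.
have old j : j < s -> satisfied c v.+1 X j -> ~ satisfied c v X j ->
    exists j0, [/\ inp 2 v 0 = X, c v = Some j0 & serves inp v j0 j].
  move=> js [ij|[u [j0 [uv bu cu su]]]] ns; first by case: ns; left.
  have [euv|ne] := eqVneq u v; first by exists j0; rewrite -euv.
  by case: ns; right; exists u, j0; split=> //; lia.
have dec j : bit R j \/ ~ satisfied c v X j \/ s <= j.
  have [js|] := ltnP j s; last by right; right.
  have [|nb] := boolP (bit R j); first by left.
  by right; left => /(bR _ js); apply/negP.
have [bX|bX] := eqVneq (inp 2 v 0) X; last first.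
  exists R; split=> //=; first by rewrite rR.
  move=> j js sj; case: (dec j) => [//|[ns|]]; last by lia.
  by have [j0 [e]] := old j js sj ns; rewrite e eqxx in bX.
case cE: (c v) => [j0|]; last first.
  exists R; split=> //=; first by rewrite rR.
  move=> j js sj; case: (dec j) => [//|[ns|]]; last by lia.
  by have [j1 [_]] := old j js sj ns; rewrite cE.
have [j0s vj0] := cv _ _ cE.
exists (served inp v j0 R); split; last 1 first.
- move=> j js sj; rewrite bit_mask js /=.
  case: (dec j) => [->|[ns|]]; [by rewrite orbT| |by lia].
  by have [j1 [_]] := old j js sj ns; rewrite cE => -[<-] ->.
- rewrite /= bX eqxx /=; apply/orP; right; apply/someP; exists R => //.
  by rewrite rR /=; apply/someP; exists j0 => //; rewrite vj0 eqxx.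
- exact: mask_lt.
Qed.

(** Choices for different bags concern different vertices, so they combine. *)
Lemma all_reach_full :
  every (fun X => reach inp n X (2 ^ s - 1)) t <->
  exists c, valid_choice c /\ forall X j, X < t -> j < s -> satisfied c n X j.
Proof.
split=> [/everyP H|[c [cv cs]]]; last first.
  apply/everyP => X Xt; have [R [rR Rs bR]] := reach_complete n cv Xt.
  rewrite -mask_full -(@eq_mask (bit R)) ?mask_bit // => j js.
  by rewrite (bR _ js) //; apply: cs.
suff upto m : m <= t -> exists c, valid_choice c /\
    forall X j, X < m -> j < s -> satisfied c n X j by apply: upto.
elim: m => [|m IH] mt; first by exists (fun=> None).
have [c [cv cs]] := IH (ltnW mt).
have [c' [cv' cs']] := reach_sound (H m mt).
exists (fun v => if inp 2 v 0 == m then c' v else c v); split=> [v j|X j].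
  by case: ifP => _; [apply: cv'|apply: cv].
rewrite ltnS leq_eqVlt => /predU1P[->|Xm] js.
  have [|ij|[v [j0 [vn bv cE sv]]]] := cs' j js.
  - by rewrite -mask_full bit_mask js.
  - by left.
  - by right; exists v, j0; rewrite bv eqxx.
have [ij|[v [j0 [vn bv cE sv]]]] := cs X j Xm js; first by left.
by right; exists v, j0; rewrite bv (ltn_eqF Xm).
Qed.

End DynamicProgram.

(** * The encoded instance *)

Lemma array1_ord n (f : 'I_n -> nat) (i : 'I_n) : array1 f i = f i.
Proof. by rewrite /array1 valK. Qed.

Lemma array1_le n (f : 'I_n -> nat) M i :
  (forall x, f x <= M) -> array1 f i <= M.
Proof. by move=> H; rewrite /array1; case: insubP => [x _ _|_] //=. Qed.

Lemma climb_toward (inp : nat -> nat -> nat -> nat) t (par : 'I_t -> 'I_t) :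
  (forall X : 'I_t, inp 3 X 0 = par X :> nat) -> forall m (b X : 'I_t),
  (climb inp m b X == 0) * inp 3 X 0 + (climb inp m b X - 1) =
  toward_fuel par m b X.
Proof.
move=> inpE; elim=> [|m IH] b X /=; rewrite val_eqE; case: (X =P b) => _.
- by rewrite mul0n subn1.
- by rewrite mul1n addn0 inpE.
- by rewrite mul0n subn1.
rewrite inpE val_eqE; case: (X =P par b) => _; first by rewrite mul0n subn1.
by rewrite -IH inpE.
Qed.

Section Bridge.

Variables (n k : nat) (G : sgraph 'I_n) (S U : 'I_k -> {set 'I_n}).
Variables (P : {set {set 'I_n}}) (E : rel {set 'I_n}).
Variables (t : nat) (bags : 'I_t -> {set 'I_n}) (r : 'I_t) (par : 'I_t -> 'I_t).
Hypotheses (treeP : partition_tree G P E)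
  (numb : rooted_numbering P E bags r par).
Hypothesis Sdisj : forall i j : 'I_k, i != j -> [disjoint S i & S j].

Definition bag_of (v : 'I_n) : 'I_t := odflt r [pick X | v \in bags X].

Lemma bag_uniq v X Y : v \in bags X -> v \in bags Y -> X = Y.
Proof.
case: treeP numb => /and3P[_ /trivIsetP triv _] _ _ _ _ [inj img _ _ _] vX vY.
have inP Z : bags Z \in P by rewrite -img imset_f.
apply: inj; apply/eqP; apply: contraLR vX => ne.
have := triv _ _ (inP X) (inP Y) ne; rewrite disjoint_sym disjoint_subset.
by move/subsetP/(_ _ vY).
Qed.

Lemma bag_pick v : [pick X | v \in bags X] = Some (bag_of v).
Proof.
rewrite /bag_of; case: pickP => [//|noX].
case: treeP numb => /and3P[/eqP cov _ _] _ _ _ _ [_ img _ _ _].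
have : v \in cover P by rewrite cov inE.
case/bigcupP=> Z; rewrite -img => /imsetP[X _ ->].
by rewrite noX.
Qed.

Lemma mem_bag v X : (v \in bags X) = (bag_of v == X).
Proof.
have vb : v \in bags (bag_of v).
  by rewrite /bag_of; case: pickP (bag_pick v) => [X0|].
by apply/idP/eqP => [vX|<- //]; apply: bag_uniq vb vX.
Qed.

Lemma par_root : par r = r. Proof. by case: numb. Qed.
Lemma par_to_root X : fconnect par X r. Proof. by case: numb. Qed.

Lemma bag_of_surj X : exists v, bag_of v = X.
Proof.
case: treeP numb => /and3P[_ _ n0] _ _ _ _ [_ img _ _ _].
have [e|[v]] := set_0Vmem (bags X); last by rewrite mem_bag => /eqP; exists v.
by case/negP: n0; rewrite -e -img imset_f.
Qed.

(** Bags are disjoint and nonempty.  This is what makes work per bag linear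
    in n. *)
Lemma bags_le : t <= n.
Proof.
have := leq_imset_card bag_of [set: 'I_n]; rewrite cardsT card_ord.
apply: leq_trans; rewrite -[t in t <= _]card_ord -cardsT.
apply/subset_leq_card/subsetP => X _.
by have [v <-] := bag_of_surj X; rewrite imset_f.
Qed.

Lemma edge_E X Y : E (bags X) (bags Y) = tree_adj par X Y.
Proof. by case: numb => _ _ _ _ ->. Qed.

Lemma bag_in X : bags X \in P.
Proof. by case: numb => _ <- *; rewrite imset_f. Qed.

Lemma bag_clique u v : bag_of u = bag_of v -> u != v -> G u v.
Proof.
case: treeP => _ _ cl _ _ e; apply: (cl _ (bag_in (bag_of u))).
  by rewrite mem_bag.
by rewrite mem_bag e.
Qed.

Lemma bag_edge u v : G u v ->
  bag_of u = bag_of v \/ tree_adj par (bag_of u) (bag_of v).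
Proof.
case: treeP => _ _ _ _ non Guv.
have [|ne] := eqVneq (bag_of u) (bag_of v); first by left.
right; rewrite -edge_E; apply: contraLR Guv => nE.
apply: (non _ _ (bag_in (bag_of u)) (bag_in (bag_of v))) => //; rewrite ?mem_bag //.
by case: numb => inj _ _ _ _; rewrite (inj_eq inj).
Qed.

Lemma bag_boundary_edge u v :
  boundary G bag_of u (bag_of v) -> boundary G bag_of v (bag_of u) -> G u v.
Proof.
case/andP=> ne /existsP[v' /andP[/eqP bv' Guv']].
case/andP=> _ /existsP[u' /andP[/eqP bu' Gvu']].
case: treeP => _ _ _ bip _.
have [//|] := bag_edge Guv'; first by move=> e; rewrite -bv' e eqxx in ne.
rewrite bv' -edge_E => /bip[X' [Y' [_ _ H]]].
have uX : u \in bags (bag_of u) by rewrite mem_bag.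
have vY : v \in bags (bag_of v) by rewrite mem_bag.
have u'X : u' \in bags (bag_of u) by rewrite mem_bag bu'.
have v'Y : v' \in bags (bag_of v) by rewrite mem_bag bv'.
have := H _ _ uX v'Y; rewrite Guv' => /esym/andP[uX' _].
have := H _ _ u'X vY; rewrite adj_sym Gvu' => /esym/andP[_ vY'].
by rewrite H // uX' vY'.
Qed.

Let inp := encode G S U bags par.

Lemma inp_bag (v : 'I_n) : inp 2 v 0 = bag_of v.
Proof. by rewrite /inp /= array1_ord bag_pick. Qed.

Lemma inp_par (X : 'I_t) : inp 3 X 0 = par X.
Proof. by rewrite /inp /= array1_ord. Qed.

Lemma inp_boundary (v : 'I_n) (Y : 'I_t) : inp 4 v Y = boundary G bag_of v Y.
Proof.
rewrite /inp /= /array2 !array1_ord /boundary mem_bag; congr (nat_of_bool (_ && _)).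
by apply: eq_existsb => w; rewrite mem_bag.
Qed.

Lemma inp_label (v : 'I_n) (l : 'I_k) : (inp 5 v 0 == l.+1) = (v \in S l).
Proof.
rewrite /inp /= array1_ord; case: pickP => [l' vl'|->] //=.
rewrite eqSS; apply/eqP/idP => [/val_inj <- //|vl].
have [-> //|ne] := eqVneq l' l.
by have := Sdisj ne; rewrite disjoint_subset => /subsetP/(_ _ vl'); rewrite inE vl.
Qed.

Lemma inp_labeled (v : 'I_n) : inp 5 v 0 != 0 -> exists l, v \in S l.
Proof. by rewrite /inp /= array1_ord; case: pickP => // l vl _; exists l. Qed.

Lemma inp_domain (v : 'I_n) (l : 'I_k) : (inp 6 l v != 0) = (v \in U l).
Proof. by rewrite /inp /= /array2 !array1_ord; case: (_ \in _). Qed.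

Lemma inp_le a i j : inp a i j <= n + k + 1.
Proof.
have tn := bags_le.
case: a => [|[|[|[|[|[|[|a]]]]]]] //=.
- by case: i => [|[|[|i]]] /=; rewrite ?nth_nil; lia.
- by apply: array1_le => x; apply: array1_le => y; case: (G _ _); lia.
- by apply: array1_le => x; case: pickP => //= X _; have := ltn_ord X; lia.
- by apply: array1_le => X; have := ltn_ord (par X); lia.
- by apply: array1_le => x; apply: array1_le => y; case: (_ && _); lia.
- by apply: array1_le => x; case: pickP => //= X _; have := ltn_ord X; lia.
- by apply: array1_le => x; apply: array1_le => y; case: (_ \in _); lia.
Qed.

Let s := size (terminals inp).

(** The program counts terminals, the time bound sums the sizes of the disjoint
    terminal sets. *)
Lemma sum_terminals : \sum_(i < k) #|S i| = s.
Proof.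
have -> : s = \sum_(v < n) (inp 5 v 0 != 0).
  rewrite /s /terminals /terminals_upto size_filter -sum1_count big_mkcond /=.
  rewrite -[X in iota _ X]subn0 -/(index_iota 0 n) big_mkord.
  by apply: eq_bigr => v _; case: (_ != 0).
under eq_bigr => i _ do rewrite -sum1_card big_mkcond.
(* on both sides a vertex counts 1 if it has a label, and 0 otherwise *)
rewrite exchange_big; apply: eq_bigr => v _.
have [e|/inp_labeled[l vl]] := eqVneq (inp 5 v 0) 0.
  by apply: big1 => l _; rewrite -inp_label e.
have eL : inp 5 v 0 = l.+1 by apply/eqP; rewrite inp_label.
rewrite (bigD1 l) //= vl big1 => [|l' ne]; first by [].
by rewrite -inp_label eL eqSS val_eqE eq_sym (negbTE ne).
Qed.

Lemma terminal_ord j : j < s ->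
  exists (w : 'I_n) (l : 'I_k),
    [/\ terminal inp j = w :> nat, inp 5 w 0 = l.+1 & w \in S l].
Proof.
move=> js; have := mem_nth 0 js; rewrite -/(terminal inp j) mem_filter mem_iota.
case/andP=> + /andP[_ lt]; rewrite add0n in lt.
rewrite -[terminal inp j]/(nat_of_ord (Ordinal lt)) => /inp_labeled[l wl].
exists (Ordinal lt), l; split=> //.
by apply/eqP; rewrite inp_label.
Qed.

Lemma ord_terminal (w : 'I_n) l : w \in S l ->
  index (val w) (terminals inp) < s /\
  terminal inp (index (val w) (terminals inp)) = w.
Proof.
move=> wl; have wt : val w \in terminals inp.
  rewrite mem_filter mem_iota leq0n add0n (ltn_ord w) !andbT.
  by move: wl; rewrite -inp_label => /eqP->.
by rewrite /s index_mem; split=> //; apply: nth_index.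
Qed.

Lemma direction_toward j (w : 'I_n) (X : 'I_t) : terminal inp j = w ->
  direction inp j X = toward par (bag_of w) X.
Proof.
by move=> e; rewrite /direction e inp_bag (climb_toward inp_par) /toward card_ord.
Qed.

Lemma every_in_domain :
  every (in_domain inp) n <-> forall l, S l \subset U l.
Proof.
split=> [/everyP H l|H].
  apply/subsetP => v vl; have := H v (ltn_ord v); rewrite /in_domain.
  by move: (vl); rewrite -inp_label => /eqP ->; rewrite succnK inp_domain.
apply/everyP => v vn; rewrite /in_domain -[v]/(nat_of_ord (Ordinal vn)).
apply/implyP => /inp_labeled[l vl].
have := vl; rewrite -inp_label => /eqP ->; rewrite succnK inp_domain.
exact: (subsetP (H l)).
Qed.

Let local := local_choice par G bag_of S U.

Lemma choice_local c : valid_choice inp c ->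
  (forall X j, X < t -> j < s -> satisfied inp c n X j) -> exists f, local f.
Proof.
move=> cv cs.
pose f (v : 'I_n) : option 'I_k :=
  obind (fun j => insub (inp 5 (terminal inp j) 0).-1) (c v).
have fE (v : 'I_n) j (l : 'I_k) : c v = Some j ->
    inp 5 (terminal inp j) 0 = l.+1 -> f v = Some l.
  move=> e eL; rewrite /f e -[LHS]/(insub (inp 5 (terminal inp j) 0).-1).
  by rewrite eL succnK valK.
exists f; split=> [v l|l w X wl /andP[nX /exists_inP[w' w'l ne]]].
  case cE: (c v) => [j|]; last by rewrite /f cE.
  have [js /andP[dv lv]] := cv _ _ cE.
  have [w [l0 [ew ll0 _]]] := terminal_ord js.
  rewrite -ew in ll0; rewrite (fE _ _ _ cE ll0) => -[<-].
  rewrite ll0 succnK inp_domain in dv; split=> // l'.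
  rewrite -inp_label => /eqP el'.
  by apply/val_inj; move: lv; rewrite el' ll0 eqSS => /eqP.
have [js tj] := ord_terminal wl; set j := index _ _ in js tj.
have [js' tj'] := ord_terminal w'l; set j' := index _ _ in js' tj'.
have busy : ~~ idle inp X j.
  rewrite /idle (direction_toward _ tj) val_eqE (negbTE nX) negbK.
  apply/someP; exists j' => //; rewrite /separated tj tj'.
  have := wl; rewrite -inp_label => /eqP->; have := w'l; rewrite -inp_label => /eqP->.
  by rewrite eqxx (direction_toward _ tj) (direction_toward _ tj') val_eqE eq_sym.
have [idl|[v [j0 [vn bv cE /andP[/eqP eL bd]]]]] := cs X j (ltn_ord X) js.
  by rewrite idl in busy.
rewrite -[v]/(nat_of_ord (Ordinal vn)) in bv cE bd.
set u := Ordinal vn in bv cE bd; exists u.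
have bu : bag_of u = X by apply/ord_inj; rewrite -inp_bag.
split=> //.
  apply: fE cE _; rewrite -eL tj; apply/eqP; by rewrite inp_label.
move: bd; rewrite bv (direction_toward _ tj) inp_boundary.
by case: (boundary _ _ _ _).
Qed.

(** A vertex chosen for index l is sent to an arbitrary representative of S_l;
    chosen vertices for an empty S_l are dropped. *)
Lemma local_valid f : local f -> exists c, valid_choice inp c /\
  forall X j, X < t -> j < s -> satisfied inp c n X j.
Proof.
case=> fdom fneed.
pose rep (l : 'I_k) : option nat :=
  omap (fun w : 'I_n => index (val w) (terminals inp)) [pick w in S l].
pose c (v : nat) : option nat := obind (fun u : 'I_n => obind rep (f u)) (insub v).
have cE (v : 'I_n) : c v = obind rep (f v) by rewrite /c valK.
have repP l j : rep l = Some j -> j < s /\ inp 5 (terminal inp j) 0 = l.+1.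
  rewrite /rep; case: pickP => //= w wl [<-]; have [js ->] := ord_terminal wl.
  by split=> //; apply/eqP; rewrite inp_label.
have repS l w : w \in S l -> exists j, rep l = Some j.
  by rewrite /rep => wl; case: pickP => [w' _|/(_ w)]; [eexists|rewrite wl].
exists c; split=> [v j|X j Xt js].
  rewrite /c; case: insubP => //= u _ <-; case fu: (f u) => [l|] //= /repP[js el].
  split=> //; have [ul only] := fdom _ _ fu.
  rewrite /joinable el succnK inp_domain ul /=.
  have [//|/inp_labeled[l' ul']] := eqVneq (inp 5 u 0) 0.
  by rewrite inp_label -(only _ ul').
have [/=|] := boolP (idle inp X j); first by left.
rewrite /idle negb_or negbK => /andP[]; rewrite -[X]/(nat_of_ord (Ordinal Xt)).
set Y := Ordinal Xt; have [w [l [tj lw wl]]] := terminal_ord js.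
rewrite (direction_toward _ tj) val_eqE => nY /someP[j' js' /andP[]].
have [w' [l' [tj' lw' w'l']]] := terminal_ord js'.
rewrite tj tj' lw lw' eqSS val_eqE => /eqP ell; rewrite -ell in w'l'.
rewrite (direction_toward _ tj) (direction_toward _ tj') val_eqE => ne.
have [|v [bv fv dv]] := fneed l w Y wl.
  by rewrite /needed nY; apply/exists_inP; exists w'; rewrite // eq_sym.
have [j0 ej0] := repS _ _ wl; have [_ el0] := repP _ _ ej0.
right; exists v, j0; split=> //; first by rewrite inp_bag bv.
  by rewrite cE fv.
rewrite /serves tj lw el0 eqxx inp_bag bv (direction_toward _ tj) inp_boundary.
by rewrite dv.
Qed.

Lemma answer_correct : answer inp <-> srdcs G S U.
Proof.
rewrite /answer; split.
  case/andP=> /every_in_domain SU /all_reach_full[c [cv cs]].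
  have [f lf] := choice_local cv cs.
  exact: (subgraphs_of_choice par_root par_to_root bag_clique
    bag_boundary_edge Sdisj SU lf).
move=> yes; apply/andP; split.
  apply/every_in_domain => l; case: yes => F [_ _ H].
  by have [H1 H2] := H l; apply: subset_trans H1 H2.
have [f lf] := choice_of_subgraphs par_root par_to_root bag_edge yes.
by apply/all_reach_full; apply: local_valid lf.
Qed.

End Bridge.

(** * The bounds *)

(** 2^(s + 3) * (n + k) bounds the numbers that the program stores, and words
    have room for its power of exponent [max_cost].  This is linear in s, and
    s <= s log s from s = 2 on. *)
Definition exponent (s : nat) : nat := max_cost * (s + 3).

Lemma exponent_slogs : O_slogs exponent.
Proof.
exists 600, 2 => s s2; have l1 : 1 <= trunc_log 2 s by rewrite trunc_log_gt0.
have : s <= s * trunc_log 2 s by rewrite leq_pmulr.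
rewrite /exponent /max_cost; lia.
Qed.

Lemma time_bound n s : 0 < n ->
  n * (2 ^ s * (s * s * 300 + s * 400 + 600)) + 100 <= 2 ^ exponent s * n.
Proof.
move=> n0; have sP : s < 2 ^ s by apply: ltn_expl.
have P1 : 0 < 2 ^ s by rewrite expn_gt0.
have poly : s * s * 300 + s * 400 + 700 <= 2 ^ s * 2 ^ s * 2 ^ 10.
  have : s.+1 * s.+1 <= 2 ^ s * 2 ^ s by rewrite leq_mul.
  rewrite -[2 ^ 10]/1024; nia.
have expo : 2 ^ s * (2 ^ s * 2 ^ s * 2 ^ 10) <= 2 ^ exponent s.
  by rewrite -!expnD leq_exp2l // /exponent /max_cost; lia.
set X := s * s * 300 + s * 400 in poly *.
have slack : 2 ^ s * (X + 600) + 100 <= 2 ^ s * (X + 700) by nia.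
have := leq_trans slack (leq_trans (leq_mul (leqnn _) poly) expo).
move: (2 ^ s * (X + 600)) (2 ^ exponent s) => y z; nia.
Qed.

Theorem theorem5p10 :
  exists (prog : cmd) (h : nat -> nat) (c : nat),
    O_slogs h /\
    forall (n k : nat) (G : sgraph 'I_n) (S U : 'I_k -> {set 'I_n})
      (P : {set {set 'I_n}}) (E : rel {set 'I_n})
      (t : nat) (bags : 'I_t -> {set 'I_n}) (r : 'I_t) (par : 'I_t -> 'I_t),
      connected_graph G ->
      partition_tree G P E ->
      rooted_numbering P E bags r par ->
      (forall i j : 'I_k, i != j -> [disjoint S i & S j]) ->
      let s := \sum_(i < k) #|S i| in
      exists (time : nat) (final : state),
        [/\ exec (2 ^ h s * (n + k) ^ c) (encode G S U bags par)
              prog init_state time final,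
            time <= 2 ^ h s * n
          & srdcs G S U <-> regs final 0 = 1].
Proof.
exists program, exponent, max_cost; split; first exact: exponent_slogs.
move=> n k G S U P E t bags r par [n0 _] treeP numb Sdisj s.
rewrite card_ord in n0.
have tn := bags_le treeP numb.
have es := sum_terminals G U bags par Sdisj; rewrite -/s in es.
pose B := 2 ^ s * (n + k + 4).
have P1 : 0 < 2 ^ s by rewrite expn_gt0.
have wd : wide (encode G S U bags par) B (2 ^ exponent s * (n + k) ^ max_cost).
  split; first by rewrite /B; nia.
    move=> a i j; have := inp_le S U treeP numb a i j; rewrite /B; nia.
  rewrite /exponent [max_cost * _]mulnC expnM -expnMn leq_exp2r //.
  by rewrite /B expnD -mulnA leq_mul2l; apply/orP; right; lia.
have PB : 2 ^ size (terminals (encode G S U bags par)) < B by rewrite -es /B; nia.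
have [time [final [ex le bf fin]]] := program_runs wd PB tn.
exists time, final; split=> //.
  by apply: leq_trans le _; rewrite -es; apply: time_bound.
rewrite fin -(answer_correct U treeP numb Sdisj).
by case: (answer _).
Qed.
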